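(* Let $f=\sum_{(i,j)\in\mathcal{A}_3}a_{ij}x^iy^j$ define a smooth elliptic curve (a smooth plane cubic) over $\mathbb{K}$ such that the valuation of its $j$-invariant is positive, $\operatorname{val}(j(f))>0$. Then its tropicalization does not have a cycle.
   Context: $\mathbb{K}=\bigcup_{N\ge1}\mathrm{Quot}(\mathbb{C}[[t^{1/N}]])$ is the field of Puiseux series over $\mathbb{C}$, with valuation $\operatorname{val}$ the lowest exponent of $t$ occurring with nonzero coefficient, $\operatorname{val}(0)=\infty$. $Q_3\subset\mathbb{R}^2$ is the triangle with vertices $(0,0),(3,0),(0,3)$ and $\mathcal{A}_3=Q_3\cap\mathbb{Z}^2$. The polynomial $f$ defines, after homogenizing to degree $3$, a cubic curve in $\mathbb{P}^2_{\mathbb{K}}$; $j(f)\in\mathbb{K}$ denotes its $j$-invariant when it is smooth. The tropicalization of the curve is the plane tropical cubic given by the tropical polynomial $\min\{\operatorname{val}(a_{ij})+ix+jy\}$, the minimum being over all $(i,j)$ in the support $S=\{(i,j)\in\mathcal{A}_3\mid a_{ij}\ne0\}$; it is the set of points in $\mathbb{R}^2$ at which the minimum is attained at least twice. Its dual marked subdivision is the family $\{(Q_\theta,\mathcal{A}_\theta)\}$ defined as follows: let $Q$ be the convex hull of $S$ and let $\mathrm{LC}:Q\to\mathbb{R}$ be the convex function whose graph is the lower boundary of the convex hull of $\{(\omega,a)\mid\omega\in S,\ a\ge\operatorname{val}(a_\omega)\}$; the $Q_\theta$ are the two-dimensional maximal domains of linearity of $\mathrm{LC}$ and $\mathcal{A}_\theta=\{\omega\in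 Q_\theta\cap S\mid \operatorname{val}(a_\omega)=\mathrm{LC}(\omega)\}$. The plane tropical cubic has a cycle if the interior lattice point $(1,1)$ of $Q_3$ is a vertex of some $Q_\theta$. *)

(* Defs.v *)
From HB Require Import structures.
From mathcomp Require Import all_boot all_order all_algebra.
(* multinomials has to be imported before the extended reals: the other order
   is rejected because of incompatible notation levels. *)
From mathcomp Require Import mpoly.
From mathcomp Require Import boolp classical_sets functions fsbigop.
From mathcomp Require Import reals constructive_ereal convex.

Set Implicit Arguments.
Unset Strict Implicit.
Unset Printing Implicit Defensive.

Import Order.TTheory GRing.Theory Num.Theory.

Local Open Scope classical_set_scope.
Local Open Scope ring_scope.

(* Cauchy products of formal power series, given by their coefficients. *)
Section CauchyProduct.
Variable F : fieldType.
Implicit Types f g h : nat -> F.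

Definition cauchy f g (n : nat) : F := \sum_(i < n.+1) f i * g (n - i)%N.

Definition trunc n f : {poly F} := \poly_(i < n.+1) f i.

Lemma cauchy_trunc f g n k : (k <= n)%N ->
  cauchy f g k = (trunc n f * trunc n g)`_k.
Proof.
move=> kn; rewrite coefM; apply: eq_bigr => i _; rewrite !coef_poly !ltnS.
have ik : (i <= k)%N by rewrite -ltnS.
by rewrite (leq_trans ik kn) (leq_trans (leq_subr _ _) kn).
Qed.

Lemma cauchyC f g : cauchy f g = cauchy g f.
Proof.
apply/funext => n.
by rewrite !(cauchy_trunc _ _ (leqnn n)) mulrC.
Qed.

Lemma cauchyA f g h : cauchy f (cauchy g h) = cauchy (cauchy f g) h.
Proof.
have key u v w n : cauchy (cauchy u v) w n =
    (trunc n u * trunc n v * trunc n w)`_n.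
  rewrite [RHS]coefM; apply: eq_bigr => i _.
  have i_n : (i <= n)%N by rewrite -ltnS.
  by rewrite (cauchy_trunc _ _ i_n) coef_poly ltnS leq_subr.
apply/funext => n.
by rewrite cauchyC !key mulrC mulrA.
Qed.

Lemma cauchyDl f g h n :
  cauchy (fun k => f k + g k) h n = cauchy f h n + cauchy g h n.
Proof. by rewrite -big_split; apply: eq_bigr => i _; rewrite mulrDl. Qed.

Definition delta (n : nat) : F := (n == 0)%:R.

Lemma cauchy1 f : cauchy delta f = f.
Proof.
apply/funext => n; rewrite /cauchy big_ord_recl subn0 mul1r big1 ?addr0 // => i _.
by rewrite mul0r.
Qed.

Fixpoint cauchy_inv_seq f n : seq F :=
  if n is n'.+1 then
    let s := cauchy_inv_seq f n' in
    rcons s ((f 0)^-1 * (delta n' - \sum_(i < n') f i.+1 * s`_(n' - i.+1)))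
  else [::].

Lemma size_cauchy_inv_seq f n : size (cauchy_inv_seq f n) = n.
Proof. by elim: n => //= n IH; rewrite size_rcons IH. Qed.

Lemma cauchy_inv_seqS f n : cauchy_inv_seq f n.+1 =
  rcons (cauchy_inv_seq f n) ((f 0)^-1 * (delta n -
    \sum_(i < n) f i.+1 * (cauchy_inv_seq f n)`_(n - i.+1))).
Proof. by []. Qed.

Lemma nth_cauchy_inv_seq f n k : (k < n)%N ->
  (cauchy_inv_seq f n)`_k = (cauchy_inv_seq f k.+1)`_k.
Proof.
elim: n => // n IH; rewrite ltnS leq_eqVlt => /predU1P[->//|kn].
by rewrite cauchy_inv_seqS nth_rcons size_cauchy_inv_seq kn IH.
Qed.

Lemma cauchy_inv f : f 0 != 0 -> exists g, cauchy f g = delta.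
Proof.
move=> f0; exists (fun n => (cauchy_inv_seq f n.+1)`_n); apply/funext => n.
rewrite /cauchy big_ord_recl subn0 cauchy_inv_seqS.
rewrite nth_rcons size_cauchy_inv_seq ltnn eqxx mulVKf //.
rewrite addrC addrCA -[RHS]addr0; congr (_ + _); apply/eqP.
rewrite subr_eq0; apply/eqP/eq_bigr => i _; congr (_ * _).
rewrite -[LHS]/((cauchy_inv_seq f (n - i.+1).+1)`_(n - i.+1)).
by rewrite [RHS]nth_cauchy_inv_seq // -subSn // subSS leq_subr.
Qed.

End CauchyProduct.

(* A Puiseux series is given by its coefficient function q |-> [t^q]: some
   N > 0 and m : int are such that all exponents occurring with a nonzero
   coefficient lie in m/N, (m+1)/N, (m+2)/N, ... *)
Definition expo (N : nat) (m : int) : rat := m%:~R / N.+1%:R.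

Definition in_grid (F : fieldType) (a : rat -> F) (N : nat) (m : int) : Prop :=
  forall q, a q != 0 -> exists k : nat, q = expo N (m + k%:Z).

Definition is_puiseux (F : fieldType) (a : rat -> F) : Prop :=
  exists N m, in_grid a N m.

Record puiseux (F : fieldType) := Puiseux {
  pcoef :> rat -> F;
  pcoefP : `[< is_puiseux pcoef >]
}.

HB.instance Definition _ (F : fieldType) := [isSub for @pcoef F].
HB.instance Definition _ (F : fieldType) := [Choice of puiseux F by <:].

Section PuiseuxField.
Variable F : fieldType.
Local Notation K := (puiseux F).
Implicit Types (x y z : K) (N : nat) (m : int).

Lemma puiseuxP x y : x =1 y -> x = y.
Proof. by move=> xy; apply/val_inj/funext. Qed.

Lemma is_puiseuxP x : is_puiseux x.
Proof. by apply/asboolP/pcoefP. Qed.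

Lemma expo_inj N : injective (expo N).
Proof.
move=> m m' /(congr1 (fun q => q * N.+1%:R)).
by rewrite !mulfVK ?pnatr_eq0 // => /intr_inj.
Qed.

Lemma expoD N m m' : expo N (m + m') = expo N m + expo N m'.
Proof. by rewrite /expo intrD mulrDl. Qed.

Lemma in_grid_leq (a : rat -> F) N m m' :
  m' <= m -> in_grid a N m -> in_grid a N m'.
Proof.
move=> le_m' am q /am[k ->]; exists (`|m - m'| + k)%N.
by rewrite PoszD gez0_abs ?subr_ge0 // addrA [m' + _]addrC subrK.
Qed.

Lemma in_grid_refine (a : rat -> F) N m (c : nat) : in_grid a N m ->
  in_grid a (N.+1 * c.+1).-1 (m * c.+1%:Z).
Proof.
move=> am q /am[k ->]; exists (k * c.+1)%N.
rewrite PoszM -mulrDl /expo prednK ?muln_gt0 // intrM natrM.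
by rewrite -mulf_div divff ?mulr1 // pnatr_eq0.
Qed.

Lemma in_grid_common (a b : rat -> F) : is_puiseux a -> is_puiseux b ->
  exists N m, in_grid a N m /\ in_grid b N m.
Proof.
move=> [N1 [m1 a1]] [N2 [m2 b2]].
exists (N1.+1 * N2.+1).-1, (Num.min (m1 * N2.+1%:Z) (m2 * N1.+1%:Z)); split.
  by apply: (in_grid_leq _ (in_grid_refine N2 a1)); rewrite ge_min lexx.
rewrite mulnC; apply: (in_grid_leq _ (in_grid_refine N1 b2)).
by rewrite ge_min lexx orbT.
Qed.

Lemma in_grid_common3 x y z : exists N m,
  [/\ in_grid x N m, in_grid y N m & in_grid z N m].
Proof.
have [N [m [xm ym]]] := in_grid_common (is_puiseuxP x) (is_puiseuxP y).
have [N' [m' zm]] := is_puiseuxP z.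
exists (N.+1 * N'.+1).-1, (Num.min (m * N'.+1%:Z) (m' * N.+1%:Z)); split.
- by apply: (in_grid_leq _ (in_grid_refine N' xm)); rewrite ge_min lexx.
- by apply: (in_grid_leq _ (in_grid_refine N' ym)); rewrite ge_min lexx.
rewrite mulnC; apply: (in_grid_leq _ (in_grid_refine N zm)).
by rewrite ge_min lexx orbT.
Qed.

(* The power series read off from a coefficient function on a grid. *)
Definition gcoef (a : rat -> F) N m (k : nat) : F := a (expo N (m + k%:Z)).

Lemma gcoef_inj (a b : rat -> F) N m : in_grid a N m -> in_grid b N m ->
  gcoef a N m =1 gcoef b N m -> a =1 b.
Proof.
move=> am bm ab q; have [aq|/eqP aq] := eqVneq (a q) 0.
  have [->//|bq] := eqVneq (b q) 0.
  by have [k qE] := bm _ bq; move: (ab k); rewrite /gcoef -qE.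
by have [k ->] := am _ (introN eqP aq); apply: ab.
Qed.

Lemma in_grid0 N m : in_grid (fun=> 0 : F) N m.
Proof. by move=> q; rewrite eqxx. Qed.

Lemma in_gridD (a b : rat -> F) N m : in_grid a N m -> in_grid b N m ->
  in_grid (fun q => a q + b q) N m.
Proof.
move=> am bm q; have [aq|aq _] := eqVneq (a q) 0; last exact: am.
by rewrite aq add0r; apply: bm.
Qed.

Lemma in_gridN (a : rat -> F) N m : in_grid a N m ->
  in_grid (fun q => - a q) N m.
Proof. by move=> am q; rewrite oppr_eq0; apply: am. Qed.

Definition pzero : K.
Proof.
by exists (fun=> 0); apply/asboolP; exists 0%N, 0; apply: in_grid0.
Defined.

Definition padd x y : K.
Proof.
exists (fun q => x q + y q); apply/asboolP.
have [N [m [xm ym]]] := in_grid_common (is_puiseuxP x) (is_puiseuxP y).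
by exists N, m; apply: in_gridD.
Defined.

Definition popp x : K.
Proof.
exists (fun q => - x q); apply/asboolP.
by have [N [m xm]] := is_puiseuxP x; exists N, m; apply: in_gridN.
Defined.

Fact paddA : associative padd.
Proof. by move=> x y z; apply: puiseuxP => q; apply: addrA. Qed.
Fact paddC : commutative padd.
Proof. by move=> x y; apply: puiseuxP => q; apply: addrC. Qed.
Fact padd0 : left_id pzero padd.
Proof. by move=> x; apply: puiseuxP => q; apply: add0r. Qed.
Fact paddN : left_inverse pzero popp padd.
Proof. by move=> x; apply: puiseuxP => q; apply: addNr. Qed.

HB.instance Definition _ := GRing.isZmodule.Build K paddA paddC padd0 paddN.

(* The coefficient of t^q in a product: a sum with finite support over all
   splittings q = p + (q - p). *)
Definition mulcoef (a b : rat -> F) (q : rat) : F :=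
  \sum_(p \in [set: rat]) a p * b (q - p).

Lemma in_gridM (a b : rat -> F) N m m' : in_grid a N m -> in_grid b N m' ->
  in_grid (mulcoef a b) N (m + m').
Proof.
move=> am bm q abq.
have [p _] : exists2 p, [set: rat] p & a p * b (q - p) != 0.
  apply: contrapT => nex; move: abq; rewrite /mulcoef fsbig1 ?eqxx // => p _.
  by apply: contrapT => /eqP abp; apply: nex; exists p.
rewrite mulf_eq0 negb_or => /andP[/am[k pE] /bm[l qpE]].
exists (k + l)%N; rewrite -[q](subrK p) qpE pE -expoD PoszD.
by rewrite [m' + _ + _]addrC addrACA.
Qed.

Lemma gcoefM (a b : rat -> F) N m m' : in_grid a N m -> in_grid b N m' ->
  gcoef (mulcoef a b) N (m + m') = cauchy (gcoef a N m) (gcoef b N m').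
Proof.
move=> am bm; apply/funext => n; rewrite /gcoef /mulcoef /cauchy.
pose e (i : 'I_n.+1) := expo N (m + (i : nat)%:Z).
have e_inj : injective e.
  by move=> i j /expo_inj/addrI[] ij; apply: val_inj.
rewrite (fsbigE (map e (enum 'I_n.+1))) //.
- rewrite big_map big_enum_cond /=; apply: eq_big => [i|i _].
    by rewrite in_setT.
  rewrite /e; congr (_ * b _); apply/eqP; rewrite subr_eq -expoD.
  rewrite [m' + _ + _]addrC addrACA -PoszD subnKC //.
  by rewrite -ltnS.
- by rewrite map_inj_uniq ?enum_uniq.
- move=> p _ pe; apply/eqP; rewrite mulf_eq0; apply/norP => -[/am[k pE]].
  move=> /bm[l]; rewrite pE => /eqP; rewrite subr_eq -expoD.
  rewrite [m' + _ + _]addrC addrACA => /eqP/expo_inj/addrI; rewrite -PoszD.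
  move=> [nE]; move/negP: pe; apply; rewrite pE; apply/mapP.
  have kn : (k < n.+1)%N by rewrite nE ltnS leq_addr.
  by exists (Ordinal kn); rewrite ?mem_enum.
Qed.

Definition pmul x y : K.
Proof.
exists (mulcoef x y); apply/asboolP.
have [N [m [xm ym]]] := in_grid_common (is_puiseuxP x) (is_puiseuxP y).
by exists N, (m + m); apply: in_gridM.
Defined.

(* The monomial c t^q. *)
Definition pmono (c : F) (q : rat) : K.
Proof.
exists (fun p => if p == q then c else 0); apply/asboolP.
exists `|denq q|.-1%N, (numq q) => p.
have [-> _|_] := eqVneq p q; last by rewrite eqxx.
exists 0%N; rewrite addr0 /expo prednK ?absz_gt0 ?denq_neq0 //.
by rewrite -[(`|_|%N)%:R]/((`|_|%N : int)%:~R) absz_denq divq_num_den.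
Defined.

Definition pone : K := pmono 1 0.

Lemma in_grid1 N : in_grid pone N 0.
Proof.
move=> q /=; have [-> _|_] := eqVneq q 0; last by rewrite eqxx.
by exists 0%N; rewrite /expo mul0r.
Qed.

Lemma gcoef1 N : gcoef pone N 0 = delta F.
Proof.
apply/funext => k; rewrite /gcoef /= add0r /delta.
have -> : (expo N k == 0) = (k == 0%N).
  by rewrite /expo mulf_eq0 invr_eq0 !pnatr_eq0 orbF.
by case: k.
Qed.

Fact pmulC : commutative pmul.
Proof.
move=> x y; have [N [m [xm ym]]] := in_grid_common (is_puiseuxP x) (is_puiseuxP y).
apply: puiseuxP; apply: (gcoef_inj (in_gridM xm ym) (in_gridM ym xm)) => k.
by rewrite !gcoefM // cauchyC.
Qed.

Fact pmulA : associative pmul.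
Proof.
move=> x y z; have [N [m [xm ym zm]]] := in_grid_common3 x y z.
have yz := in_gridM ym zm; have xy := in_gridM xm ym.
have xyz := in_gridM xy zm; rewrite -addrA in xyz.
apply: puiseuxP; apply: (gcoef_inj (in_gridM xm yz) xyz) => k.
by rewrite gcoefM // gcoefM // addrA gcoefM // gcoefM // cauchyA.
Qed.

Fact pmul1 : left_id pone pmul.
Proof.
move=> x; have [N [m xm]] := is_puiseuxP x.
have x1 := in_gridM (in_grid1 N) xm; rewrite add0r in x1.
apply: puiseuxP; apply: (gcoef_inj x1 xm) => k.
by rewrite -{1}[m]add0r gcoefM ?gcoef1 ?cauchy1 //; apply: in_grid1.
Qed.

Fact pmulDl : left_distributive pmul padd.
Proof.
move=> x y z; have [N [m [xm ym zm]]] := in_grid_common3 x y z.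
have xz := in_gridM xm zm; have yz := in_gridM ym zm.
have xy : in_grid (padd x y) N m := in_gridD xm ym.
apply: puiseuxP; apply: (gcoef_inj (in_gridM xy zm) (in_gridD xz yz)) => k.
by rewrite gcoefM // cauchyDl -!gcoefM.
Qed.

Fact pone_neq0 : pone != 0.
Proof.
apply/eqP => /(congr1 (fun x : K => x 0)) /= /eqP.
by rewrite oner_eq0.
Qed.

HB.instance Definition _ := GRing.Zmodule_isComNzRing.Build K
  pmulA pmulC pmul1 pmulDl pone_neq0.

Lemma neq0_coef x : x != 0 -> exists q, x q != 0.
Proof.
move=> /eqP x0; apply: contrapT => nex; apply: x0; apply: puiseuxP => q.
by apply: contrapT => /eqP xq; apply: nex; exists q.
Qed.

(* The least exponent of a nonzero series, as the start of a grid. *)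
Lemma in_grid_tight x : x != 0 ->
  exists N m, in_grid x N m /\ x (expo N m) != 0.
Proof.
move=> /neq0_coef[q xq]; have [N [m xm]] := is_puiseuxP x.
have ex : exists k : nat, x (expo N (m + k%:Z)) != 0.
  by have [k qE] := xm _ xq; exists k; rewrite -qE.
exists N, (m + (ex_minn ex)%:Z); case: ex_minnP => k xk kmin; split=> // p xp.
have [l pE] := xm _ xp; exists (l - k)%N.
by rewrite pE -addrA -PoszD subnKC // kmin // -pE.
Qed.

Lemma pinv_exists x : x != 0 -> exists y, y * x = 1.
Proof.
move=> /in_grid_tight[N [m [xm xm0]]].
have [|g gP] := @cauchy_inv F (gcoef x N m); first by rewrite /gcoef addr0.
pose a q : F := if pselect (exists k : nat, q = expo N (- m + k%:Z)) is left ex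
  then g (projT1 (cid ex)) else 0.
have am : in_grid a N (- m).
  by move=> q; rewrite /a; case: pselect => // _; rewrite eqxx.
have aE : gcoef a N (- m) = g.
  apply/funext => k; rewrite /gcoef /a; case: pselect => [ex|[]]; last by exists k.
  by case: (cid ex) => l /= /expo_inj/addrI[->].
have aP : `[< is_puiseux a >] by apply/asboolP; exists N, (- m).
exists (Puiseux aP); apply: puiseuxP.
have ax := in_gridM am xm; rewrite addNr in ax.
apply: (gcoef_inj ax (in_grid1 N)) => k.
by rewrite gcoef1 -[0](addNr m) gcoefM // aE cauchyC gP.
Qed.

(* xget is a choice operator: pinv x is the inverse if there is one, else 0. *)
Definition pinv x : K := xget 0 [set y | y * x = 1].

Fact pmulV x : x != 0 -> pinv x * x = 1.
Proof.
by move=> /pinv_exists[y yx]; rewrite /pinv; case: xgetP => [z _ //|/(_ y)].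
Qed.

Fact pinv0 : pinv 0 = 0.
Proof.
rewrite /pinv; case: xgetP => // y _ /= /eqP.
by rewrite mulr0 eq_sym oner_eq0.
Qed.

HB.instance Definition _ := GRing.ComNzRing_isField.Build K pmulV pinv0.

(* The lowest exponent occurring with a nonzero coefficient. *)
Definition pval x : \bar rat :=
  if x == 0 then +oo%E
  else (xget 0 [set q | x q != 0 /\ forall p, x p != 0 -> q <= p])%:E.

Lemma pvalP x : x != 0 -> exists q,
  [/\ pval x = q%:E, x q != 0 & forall p, x p != 0 -> q <= p].
Proof.
move=> x0; have [N [m [xm xm0]]] := in_grid_tight x0.
rewrite /pval (negPf x0); case: xgetP => [q _ [xq qmin]|/(_ (expo N m))[]].
  by exists q.
split=> // p /xm[k ->]; rewrite expoD lerDl.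
by rewrite divr_ge0 ?ler0n // ler0z.
Qed.

End PuiseuxField.

(* Plane cubics in homogeneous coordinates ('X_0 : 'X_1 : 'X_2). *)
Section PlaneCubics.
Variable K : fieldType.
Implicit Types (f : {mpoly K[2]}) (G H : {mpoly K[3]}).

(* Meant for msize f <= 4, i.e. for f supported on the lattice points of the
   triangle with vertices (0,0), (3,0), (0,3); 3 - mdeg m is truncated otherwise. *)
Definition homogenize3 f : {mpoly K[3]} :=
  \sum_(m <- msupp f)
    f@_m *: 'X_[[multinom [tuple m ord0; m ord_max; (3 - mdeg m)%N]]].

(* Jacobian criterion at the K-points; it is meant for algebraically closed K. *)
Definition smooth_curve G : Prop :=
  forall v : 'I_3 -> K, (exists i, v i != 0) ->
    G.@[v] = 0 -> exists i, (G^`M(i)).@[v] != 0.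

Definition proj_equiv G H : Prop :=
  exists (M : 'M[K]_3) (c : K), [/\ M \in unitmx, c != 0 &
    G \mPo [tuple \sum_j M i j *: 'X_j | i < 3] = c *: H].

(* y^2 z = x^3 + A x z^2 + B z^3 *)
Definition weierstrass (A B : K) : {mpoly K[3]} :=
  let x := 'X_0 in let y := 'X_1 in let z := 'X_2 in
  y ^+ 2 * z - (x ^+ 3 + A *: (x * z ^+ 2) + B *: z ^+ 3).

(* [is_jinv G j]: j is the j-invariant of the smooth cubic G. In characteristic
   0 and over an algebraically closed field every smooth cubic has a short
   Weierstrass form, and the value of j does not depend on its choice. *)
Definition is_jinv G (j : K) : Prop :=
  exists A B : K, proj_equiv G (weierstrass A B) /\
    j = 1728%:R * (4%:R * A ^+ 3) / (4%:R * A ^+ 3 + 27%:R * B ^+ 2).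

End PlaneCubics.

(* A tropical polynomial in two variables is given by its coefficients
   w : 'X_{1..2} -> \bar R, where +oo stands for an absent monomial. The curve
   is represented by w: the marked subdivision depends on w, not only on the
   set of points at which the tropical polynomial attains its minimum twice. *)
Section TropicalCurves.
Variable R : realType.
Local Notation plane := 'rV[R]_2.
Implicit Types (w : 'X_{1..2} -> \bar R) (D : set plane) (p q r : plane).

Definition lattice_pt (m : 'X_{1..2}) : plane := \row_i (m i)%:R.

Definition hull (M : lmodType R) (A : set M) : set M :=
  smallest (@convex_set R M) A.

Definition trop_supp w : set 'X_{1..2} := [set m | w m \is a fin_num].

Definition newton_polygon w : set plane := hull (lattice_pt @` trop_supp w).

Definition lifted_points w : set (plane * R^o) :=
  [set pa | exists m, [/\ trop_supp w m, pa.1 = lattice_pt m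
                        & (w m <= pa.2%:E)%E]].

(* The convex function whose graph is the lower boundary of the hull of the
   lifted points; it is only meaningful on newton_polygon w. *)
Definition LC w p : R := inf [set a | hull (lifted_points w) (p, a)].

Definition affine_on D (g : plane -> R) : Prop :=
  exists (u : 'cV[R]_2) (c : R), forall p, D p -> g p = (p *m u) 0 0 + c.

Definition linearity_domain w D : Prop :=
  [/\ D `<=` newton_polygon w, @convex_set R plane D & affine_on D (LC w)].

(* Applied to convex D only, for which three affinely independent points mean
   dimension 2. *)
Definition two_dimensional D : Prop :=
  exists p q r, [/\ D p, D q, D r & row_free (col_mx (q - p) (r - p))].

(* The pairs (Q_theta, A_theta). *)
Definition marked_subdivision w : set (set plane * set 'X_{1..2}) :=
  [set t | [/\ linearity_domain w t.1,
               forall D, linearity_domain w D -> t.1 `<=` D -> D = t.1,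
               two_dimensional t.1 &
               t.2 = [set m | [/\ t.1 (lattice_pt m), trop_supp w m &
                                  w m = (LC w (lattice_pt m))%:E]]]].

Definition vertex D p : Prop :=
  D p /\ forall q r (t : R), D q -> D r -> 0 < t < 1 ->
    p = t *: q + (1 - t) *: r -> q = p /\ r = p.

Definition has_cycle w : Prop :=
  exists2 t, marked_subdivision w t &
    vertex t.1 (lattice_pt [multinom [tuple 1%N; 1%N]]).

Definition tropicalization (F : fieldType) (f : {mpoly (puiseux F)[2]}) :
  'X_{1..2} -> \bar R := fun m => er_map ratr (pval f@_m).

End TropicalCurves.

(* Main.v *)
Require Import Defs.
From HB Require Import structures.
From mathcomp Require Import all_boot all_order all_algebra.
From mathcomp Require Import mpoly.
From mathcomp Require Import boolp classical_sets fsbigop.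
From mathcomp Require Import reals constructive_ereal complex.
From mathcomp Require Import interval_inference convex.
From mathcomp Require Import ring lra.

Set Implicit Arguments.
Unset Strict Implicit.
Unset Printing Implicit Defensive.

Import Order.TTheory GRing.Theory Num.Theory.

Local Open Scope ring_scope.

(* The two SL_3-invariants S and T of ternary cubics, of degrees 4 and 6, are
   -1152 A and 41472 B on y^2 z = x^3 + A x z^2 + B z^3, so that
   j = 1728 * 4 A^3 / (4 A^3 + 27 B^2) satisfies
   j * (24 T^2 - 4 S^3) = - 6912 S^3 for every smooth cubic.
   If (1,1) is a vertex of the subdivision, some affine function agrees with the
   heights at (1,1) and lies strictly below them at the other points of the
   support; moving it slightly, its slopes can be taken rational. Rescaling the
   coordinates by powers of t then turns f into a cubic with coefficients in the
   valuation ring whose residue is a nonzero multiple of xyz. On xyz the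
   invariant S does not vanish, so S is a unit of the valuation ring whereas T
   is integral; the relation above excludes val(j) > 0. *)

(** * Invariants of ternary cubics *)

Definition o0 : 'I_3 := Ordinal (isT : 0 < 3)%N.
Definition o1 : 'I_3 := Ordinal (isT : 1 < 3)%N.
Definition o2 : 'I_3 := Ordinal (isT : 2 < 3)%N.

Lemma sum3E (V : nmodType) (F : 'I_3 -> V) :
  \sum_i F i = F o0 + F o1 + F o2.
Proof.
rewrite !big_ord_recl big_ord0 addr0 addrA.
by congr (F _ + F _ + F _); apply: val_inj.
Qed.

Lemma ord3P (P : 'I_3 -> Prop) : P o0 -> P o1 -> P o2 -> forall i, P i.
Proof.
by move=> P0 P1 P2 [[|[|[|//]]] i3]; [move: P0|move: P1|move: P2];
  congr P; apply: val_inj.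
Qed.

Lemma ordS3E : (ordS o0 = o1) * (ordS o1 = o2) * (ordS o2 = o0).
Proof. by split; [split|]; apply: val_inj. Qed.

Section Invariants.
Variable F : comNzRingType.
Implicit Types (M N P Q X Y : 'M[F]_3).

(* A ternary cubic is encoded by its third partial derivatives. *)
Definition tensor := 'I_3 -> 'M[F]_3.
Implicit Types A B C D : tensor.

(** The action on third derivatives of the substitution v -> M v in the cubic. *)
Definition act M A : tensor := fun i => M^T *m (\sum_p M p i *: A p) *m M.

(* The polarization of the quadratic map X |-> 2 (\adj X)^T on 3x3 matrices. *)
Definition mixadj X Y : 'M[F]_3 := \matrix_(a, b)
  (X (ordS a) (ordS b) * Y (ordS (ordS a)) (ordS (ordS b))
   + Y (ordS a) (ordS b) * X (ordS (ordS a)) (ordS (ordS b))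
   - X (ordS a) (ordS (ordS b)) * Y (ordS (ordS a)) (ordS b)
   - Y (ordS a) (ordS (ordS b)) * X (ordS (ordS a)) (ordS b)).

(** The adjugate and, next, the determinant as explicit polynomials, so that identities between them
    are decided by [ring]. The cyclic indices [ordS] absorb the cofactor signs. *)
Definition adj3 M : 'M[F]_3 := \matrix_(b, a)
  (M (ordS a) (ordS b) * M (ordS (ordS a)) (ordS (ordS b))
   - M (ordS a) (ordS (ordS b)) * M (ordS (ordS a)) (ordS b)).

Definition det3 M : F :=
  M o0 o0 * (M o1 o1 * M o2 o2 - M o1 o2 * M o2 o1)
  - M o0 o1 * (M o1 o0 * M o2 o2 - M o1 o2 * M o2 o0)
  + M o0 o2 * (M o1 o0 * M o2 o1 - M o1 o1 * M o2 o0).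

Lemma det3M M N : det3 (M *m N) = det3 M * det3 N.
Proof. by rewrite /det3 !mxE !sum3E; ring. Qed.

Lemma det31 : det3 1%:M = 1.
Proof. by rewrite /det3 !mxE /=; ring. Qed.

Lemma mul_mx_adj3 M : M *m adj3 M = (det3 M)%:M.
Proof.
apply/matrixP; apply: ord3P; apply: ord3P;
  by rewrite !mxE sum3E !mxE !ordS3E /det3 /= ?mulr1n ?mulr0n; ring.
Qed.

(** Polarized multiplicativity of cofactor matrices: cof(M^T X M) = adj(M) cof(X) adj(M)^T. *)
Lemma mixadj_act M X Y :
  mixadj (M^T *m X *m M) (M^T *m Y *m M) = adj3 M *m mixadj X Y *m (adj3 M)^T.
Proof.
apply/matrixP => a b.
by rewrite !(mxE, sum3E) !ordS3E; ring.
Qed.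

Lemma mixadj_suml X Y Z a b c T : mixadj (a *: X + b *: Y + c *: Z) T =
  a *: mixadj X T + b *: mixadj Y T + c *: mixadj Z T.
Proof. by apply/matrixP => i j; rewrite !mxE; ring. Qed.

Lemma mixadj_sumr X Y Z a b c T : mixadj T (a *: X + b *: Y + c *: Z) =
  a *: mixadj T X + b *: mixadj T Y + c *: mixadj T Z.
Proof. by apply/matrixP => i j; rewrite !mxE; ring. Qed.

Lemma mixadjZ a b X Y : mixadj (a *: X) (b *: Y) = (a * b) *: mixadj X Y.
Proof. by apply/matrixP => i j; rewrite !mxE; ring. Qed.

Lemma mixadj_act_tensor M A B i j : mixadj (act M A i) (act M B j) =
  adj3 M *m (\sum_k \sum_l (M k i * M l j) *: mixadj (A k) (B l)) *m (adj3 M)^T.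
Proof.
rewrite mixadj_act; congr (_ *m _ *m _).
by rewrite !sum3E mixadj_suml !mixadj_sumr !scalerDr !scalerA.
Qed.

Definition sandwich M P := M *m P *m M^T.

(** An endomorphism of the space of 3x3 matrices, bilinear in (A, B); the invariants are traces of
    composites of two such maps. *)
Definition polar_op A B P := \sum_i \sum_j P i j *: mixadj (A i) (B j).

(** The index slots of the tensors move M onto the argument P, while [mixadj] turns the congruence
    by M in the matrix slots into a congruence by the adjugate. *)
Lemma polar_op_act M A B P : polar_op (act M A) (act M B) P =
  sandwich (adj3 M) (polar_op A B (sandwich M P)).
Proof.
rewrite /polar_op /sandwich.
transitivity (\sum_i \sum_j adj3 M *m
    (\sum_k \sum_l (P i j * (M k i * M l j)) *: mixadj (A k) (B l)) *m
    (adj3 M)^T).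
  apply: eq_bigr => i _; apply: eq_bigr => j _; rewrite mixadj_act_tensor.
  rewrite scalemxAl scalemxAr; congr (_ *m _ *m _).
  rewrite scaler_sumr; apply: eq_bigr => k _; rewrite scaler_sumr.
  by apply: eq_bigr => l _; rewrite scalerA.
under eq_bigr do rewrite -mulmx_suml -mulmx_sumr.
rewrite -mulmx_suml -mulmx_sumr; congr (_ *m _ *m _).
under eq_bigr do rewrite exchange_big.
rewrite exchange_big; apply: eq_bigr => k _ /=.
under eq_bigr do rewrite exchange_big.
rewrite exchange_big; apply: eq_bigr => l _ /=.
under eq_bigr do rewrite -scaler_suml.
rewrite -scaler_suml; congr (_ *: _).
rewrite !mxE exchange_big; apply: eq_bigr => j _ /=.
by rewrite !mxE big_distrl; apply: eq_bigr => i _ /=; ring.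
Qed.

Definition trace_comp (f g : 'M[F]_3 -> 'M[F]_3) : F :=
  \sum_i \sum_j f (g (delta_mx i j)) i j.

Lemma lin_delta (f : {linear 'M[F]_3 -> 'M[F]_3}) P a b :
  f P a b = \sum_i \sum_j P i j * f (delta_mx i j) a b.
Proof.
rewrite {1}[P]matrix_sum_delta linear_sum summxE; apply: eq_bigr => i _.
by rewrite linear_sum summxE; apply: eq_bigr => j _; rewrite linearZ mxE.
Qed.

Lemma trace_compC (f g : {linear 'M[F]_3 -> 'M[F]_3}) :
  trace_comp f g = trace_comp g f.
Proof.
rewrite /trace_comp; under eq_bigr do under eq_bigr do rewrite lin_delta.
under [RHS]eq_bigr do under eq_bigr do rewrite lin_delta.
under eq_bigr do rewrite exchange_big.
rewrite exchange_big; apply: eq_bigr => k _ /=.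
under eq_bigr do rewrite exchange_big.
rewrite exchange_big; apply: eq_bigr => l _ /=.
by apply: eq_bigr => i _; apply: eq_bigr => j _; rewrite mulrC.
Qed.

Fact sandwich_is_linear M : linear (sandwich M).
Proof. by move=> a P Q; rewrite /sandwich mulmxDr mulmxDl -scalemxAr -scalemxAl. Qed.
HB.instance Definition _ M :=
  GRing.isLinear.Build F _ _ _ (sandwich M) (sandwich_is_linear M).

Fact polar_op_is_linear A B : linear (polar_op A B).
Proof.
move=> a P Q; rewrite /polar_op scaler_sumr -big_split; apply: eq_bigr => i _ /=.
rewrite scaler_sumr -big_split; apply: eq_bigr => j _ /=.
by rewrite !mxE scalerDl scalerA.
Qed.
HB.instance Definition _ A B :=
  GRing.isLinear.Build F _ _ _ (polar_op A B) (polar_op_is_linear A B).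

Lemma sandwich_adj3 M P : sandwich M (sandwich (adj3 M) P) = det3 M ^+ 2 *: P.
Proof.
rewrite /sandwich !mulmxA mul_mx_adj3 -!mulmxA -trmx_mul mul_mx_adj3 tr_scalar_mx.
by rewrite mul_scalar_mx mul_mx_scalar scalerA.
Qed.

Definition optrace A B C D : F := trace_comp (polar_op A B) (polar_op C D).

(** At each of the two junctions of the composite, [sandwich M] meets [sandwich (adj3 M)] and leaves
    det^2; the outer junction is reached by cyclicity of the trace. *)
Lemma optrace_act M A B C D :
  optrace (act M A) (act M B) (act M C) (act M D) = det3 M ^+ 4 * optrace A B C D.
Proof.
rewrite /optrace.
transitivity (det3 M ^+ 2 * trace_comp (sandwich (adj3 M))
    (polar_op A B \o polar_op C D \o sandwich M)).
  rewrite /trace_comp mulr_sumr; apply: eq_bigr => i _; rewrite mulr_sumr.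
  apply: eq_bigr => j _ /=; rewrite !polar_op_act sandwich_adj3 linearZ /= linearZ /=.
  by rewrite mxE.
rewrite trace_compC /trace_comp !mulr_sumr; apply: eq_bigr => i _; rewrite !mulr_sumr.
apply: eq_bigr => j _ /=; rewrite sandwich_adj3 linearZ /= linearZ /= mxE mulrA.
by rewrite -exprD.
Qed.

(** The pairing of [mixadj X Y] with Z is the full polarization of the determinant, equal to 6 det X
    at X = Y = Z. Hence this is the tensor of the Hessian determinant of the cubic encoded by A. *)
Definition hess A : tensor := fun i =>
  \matrix_(j, k) \sum_a \sum_b mixadj (A i) (A j) a b * A k a b.

(* Up to constant factors, Aronhold's invariants: invT is the derivative of invS
   in the direction of the Hessian. *)
Definition invS A := optrace A A A A.
Definition invT A := optrace A A A (hess A).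

End Invariants.

(** * Weights and degrees of the invariants, and their values on two normal forms *)

Section Covariance.
Variable F : comNzRingType.
Implicit Types (M N P Q X Y : 'M[F]_3) (A B C D : tensor F).

Lemma actE M A i j k : act M A i j k =
  \sum_p \sum_q \sum_r M p i * M q j * M r k * A p q r.
Proof. by rewrite !(mxE, sum3E); ring. Qed.

Lemma mixadj_trace_sandwich M X Y :
  \sum_a \sum_b (adj3 M *m X *m (adj3 M)^T) a b * (M^T *m Y *m M) a b =
  det3 M ^+ 2 * \sum_a \sum_b X a b * Y a b.
Proof.
have trE X' Y' : \sum_a \sum_b X' a b * Y' a b = \tr (X' *m Y'^T) :> F.
  by apply: eq_bigr => i _; rewrite mxE; apply: eq_bigr => j _; rewrite mxE.
rewrite !trE !trmx_mul trmxK !mulmxA mxtrace_mulC !mulmxA mul_mx_adj3.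
rewrite -[_ *m (adj3 M)^T *m _]mulmxA -trmx_mul mul_mx_adj3 tr_scalar_mx.
by rewrite mul_scalar_mx mul_mx_scalar scalerA -scalemxAl linearZ.
Qed.

Lemma hess_act M A i j k :
  hess (act M A) i j k = det3 M ^+ 2 * act M (hess A) i j k.
Proof.
rewrite mxE; under eq_bigr do under eq_bigr do rewrite mixadj_act_tensor.
rewrite mixadj_trace_sandwich // actE; congr (_ * _); rewrite /hess.
(* The identity that remains holds for arbitrary values of [mixadj], which is generalized so that
   its entries stay atoms. *)
by move: (@mixadj F) => h; rewrite !(sum3E, mxE); ring.
Qed.

Lemma optrace_ext A A' B B' C C' D D' : A =1 A' -> B =1 B' -> C =1 C' ->
  D =1 D' -> optrace A B C D = optrace A' B' C' D'.
Proof.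
move=> eqA eqB eqC eqD.
have polar_op_ext (A1 A2 B1 B2 : tensor F) P :
    A1 =1 A2 -> B1 =1 B2 -> polar_op A1 B1 P = polar_op A2 B2 P.
  move=> eq1 eq2; apply: eq_bigr => i _; apply: eq_bigr => j _.
  by rewrite eq1 eq2.
apply: eq_bigr => i _; apply: eq_bigr => j _.
by rewrite (polar_op_ext _ _ _ _ _ eqA eqB) (polar_op_ext _ _ _ _ _ eqC eqD).
Qed.

Lemma polar_opZ a b A B P :
  polar_op (fun i => a *: A i) (fun i => b *: B i) P = (a * b) *: polar_op A B P.
Proof.
rewrite /polar_op scaler_sumr; apply: eq_bigr => i _; rewrite scaler_sumr.
by apply: eq_bigr => j _; rewrite mixadjZ !scalerA mulrC.
Qed.

Lemma optraceZ a b c d A B C D :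
  optrace (fun i => a *: A i) (fun i => b *: B i) (fun i => c *: C i)
    (fun i => d *: D i) = a * b * c * d * optrace A B C D.
Proof.
rewrite /optrace /trace_comp mulr_sumr; apply: eq_bigr => i _; rewrite mulr_sumr.
by apply: eq_bigr => j _; rewrite !polar_opZ linearZ /= !mxE; ring.
Qed.

Lemma hessZ a A i : hess (fun i => a *: A i) i = a ^+ 3 *: hess A i.
Proof.
apply/matrixP => j k; rewrite !mxE mulr_sumr; apply: eq_bigr => p _.
by rewrite mulr_sumr; apply: eq_bigr => q _; rewrite mixadjZ !mxE; ring.
Qed.

Lemma invS_act M A : invS (act M A) = det3 M ^+ 4 * invS A.
Proof. exact: optrace_act. Qed.

Lemma invT_act M A : invT (act M A) = det3 M ^+ 6 * invT A.
Proof.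
(* Trivial factors 1 give all four arguments the shape of [optraceZ]. The weight 6 is 4 from the
   trace plus 2 from the Hessian. *)
pose one (C : tensor F) : tensor F := fun i => 1 *: C i.
transitivity (optrace (one (act M A)) (one (act M A)) (one (act M A))
    (fun i => det3 M ^+ 2 *: act M (hess A) i)).
  apply: optrace_ext => i; rewrite /one ?scale1r //.
  by apply/matrixP => j k; rewrite [RHS]mxE hess_act.
by rewrite optraceZ optrace_act /invT; ring.
Qed.

Lemma invSZ a A : invS (fun i => a *: A i) = a ^+ 4 * invS A.
Proof. by rewrite /invS optraceZ; ring. Qed.

Lemma invTZ a A : invT (fun i => a *: A i) = a ^+ 6 * invT A.
Proof.
rewrite /invT (optrace_ext (fun=> erefl) (fun=> erefl) (fun=> erefl) (hessZ a A)).
by rewrite optraceZ; ring.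
Qed.

Lemma optraceE A B C D : optrace A B C D = \sum_i \sum_j \sum_a \sum_b
  mixadj (C i) (D j) a b * mixadj (A a) (B b) i j.
Proof.
apply: eq_bigr => i _; apply: eq_bigr => j _.
have polar_opE P A' B' : polar_op A' B' P i j =
    \sum_a \sum_b P a b * mixadj (A' a) (B' b) i j.
  rewrite /polar_op summxE; apply: eq_bigr => a _; rewrite summxE.
  by apply: eq_bigr => b _; rewrite mxE.
rewrite polar_opE; apply: eq_bigr => a _; apply: eq_bigr => b _; congr (_ * _).
suff -> : polar_op C D (delta_mx i j) = mixadj (C i) (D j) by [].
rewrite /polar_op (bigD1 i) //= (bigD1 j) //= mxE !eqxx scale1r.
rewrite [X in _ + X + _]big1 => [|l lj]; last first.
  by rewrite mxE (negPf lj) andbF scale0r.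
rewrite addr0 big1 ?addr0 // => l li.
by apply: big1 => l' _; rewrite mxE (negPf li) scale0r.
Qed.

Definition occ (p i j k : 'I_3) : nat := ((i == p) + (j == p) + (k == p))%N.

(* The third derivatives of the cubic form with coefficient [c m n] at
   x^m y^n z^(3-m-n). *)
Definition symt (c : nat -> nat -> F) : tensor F := fun i => \matrix_(j, k)
  (((occ o0 i j k)`! * (occ o1 i j k)`! * (occ o2 i j k)`!)%:R
   * c (occ o0 i j k) (occ o1 i j k)).

Lemma symtE (c : nat -> nat -> F) :
  (symt c o0 o0 o0 = 6%:R * c 3%N 0%N)
  * (symt c o0 o0 o1 = 2%:R * c 2%N 1%N)
  * (symt c o0 o0 o2 = 2%:R * c 2%N 0%N)
  * (symt c o0 o1 o0 = 2%:R * c 2%N 1%N)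
  * (symt c o0 o1 o1 = 2%:R * c 1%N 2%N)
  * (symt c o0 o1 o2 = 1%:R * c 1%N 1%N)
  * (symt c o0 o2 o0 = 2%:R * c 2%N 0%N)
  * (symt c o0 o2 o1 = 1%:R * c 1%N 1%N)
  * (symt c o0 o2 o2 = 2%:R * c 1%N 0%N)
  * (symt c o1 o0 o0 = 2%:R * c 2%N 1%N)
  * (symt c o1 o0 o1 = 2%:R * c 1%N 2%N)
  * (symt c o1 o0 o2 = 1%:R * c 1%N 1%N)
  * (symt c o1 o1 o0 = 2%:R * c 1%N 2%N)
  * (symt c o1 o1 o1 = 6%:R * c 0%N 3%N)
  * (symt c o1 o1 o2 = 2%:R * c 0%N 2%N)
  * (symt c o1 o2 o0 = 1%:R * c 1%N 1%N)
  * (symt c o1 o2 o1 = 2%:R * c 0%N 2%N)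
  * (symt c o1 o2 o2 = 2%:R * c 0%N 1%N)
  * (symt c o2 o0 o0 = 2%:R * c 2%N 0%N)
  * (symt c o2 o0 o1 = 1%:R * c 1%N 1%N)
  * (symt c o2 o0 o2 = 2%:R * c 1%N 0%N)
  * (symt c o2 o1 o0 = 1%:R * c 1%N 1%N)
  * (symt c o2 o1 o1 = 2%:R * c 0%N 2%N)
  * (symt c o2 o1 o2 = 2%:R * c 0%N 1%N)
  * (symt c o2 o2 o0 = 2%:R * c 1%N 0%N)
  * (symt c o2 o2 o1 = 2%:R * c 0%N 1%N)
  * (symt c o2 o2 o2 = 6%:R * c 0%N 0%N).
Proof. by do ![split]; rewrite mxE. Qed.

Definition weic (a b : F) (m n : nat) : F :=
  match m, n with
  | 3%N, 0%N => -1 | 0%N, 2%N => 1 | 1%N, 0%N => - a | 0%N, 0%N => - b | _, _ => 0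
  end.

Definition xyzc (m n : nat) : F :=
  match m, n with 1%N, 1%N => 1 | _, _ => 0 end.

(** The Hessian determinant of y^2 z - x^3 - a x z^2 - b z^3, which is 24 x y^2 + 24 a x^2 z + 72 b
    x z^2 - 8 a^2 z^3. *)
Definition hweic (a b : F) (m n : nat) : F :=
  match m, n with
  | 2%N, 0%N => 24%:R * a | 1%N, 2%N => 24%:R | 1%N, 0%N => 72%:R * b
  | 0%N, 0%N => - 8%:R * a ^+ 2 | _, _ => 0
  end.

Lemma mixadjE X Y a b : mixadj X Y a b =
  X (ordS a) (ordS b) * Y (ordS (ordS a)) (ordS (ordS b))
  + Y (ordS a) (ordS b) * X (ordS (ordS a)) (ordS (ordS b))
  - X (ordS a) (ordS (ordS b)) * Y (ordS (ordS a)) (ordS b)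
  - Y (ordS a) (ordS (ordS b)) * X (ordS (ordS a)) (ordS b).
Proof. by rewrite mxE. Qed.

Lemma hess_wei a b : hess (symt (weic a b)) =1 symt (hweic a b).
Proof.
move=> i; apply/matrixP => j k; rewrite [LHS]mxE.
under eq_bigr do under eq_bigr do rewrite mixadjE.
rewrite !sum3E !ordS3E.
move: i j k; apply: ord3P; apply: ord3P; apply: ord3P; rewrite !symtE /=; ring.
Qed.

Lemma optraceE4 A B C D : optrace A B C D = \sum_i \sum_j \sum_a \sum_b
  (C i (ordS a) (ordS b) * D j (ordS (ordS a)) (ordS (ordS b))
   + D j (ordS a) (ordS b) * C i (ordS (ordS a)) (ordS (ordS b))
   - C i (ordS a) (ordS (ordS b)) * D j (ordS (ordS a)) (ordS b)
   - D j (ordS a) (ordS (ordS b)) * C i (ordS (ordS a)) (ordS b)) *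
  (A a (ordS i) (ordS j) * B b (ordS (ordS i)) (ordS (ordS j))
   + B b (ordS i) (ordS j) * A a (ordS (ordS i)) (ordS (ordS j))
   - A a (ordS i) (ordS (ordS j)) * B b (ordS (ordS i)) (ordS j)
   - B b (ordS i) (ordS (ordS j)) * A a (ordS (ordS i)) (ordS j)).
Proof.
by rewrite optraceE; under eq_bigr do under eq_bigr do under eq_bigr do
  under eq_bigr do rewrite !mixadjE.
Qed.

Lemma invS_wei a b : invS (symt (weic a b)) = - 1152%:R * a.
Proof. by rewrite /invS optraceE4 !sum3E !ordS3E !symtE /=; ring. Qed.

Lemma invT_wei a b : invT (symt (weic a b)) = 288%:R * 144%:R * b.
Proof.
rewrite /invT (optrace_ext (fun=> erefl) (fun=> erefl) (fun=> erefl) (@hess_wei a b)).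
by rewrite optraceE4 !sum3E !ordS3E !symtE /=; ring.
Qed.

(** In characteristic 0 this value is nonzero, so S is a unit for any integral cubic that reduces to
    a nonzero multiple of xyz. *)
Lemma invS_xyz : invS (symt xyzc) = 24%:R.
Proof. by rewrite /invS optraceE4 !sum3E !ordS3E !symtE /xyzc /=; ring. Qed.

End Covariance.

Lemma invS_ext (F : comNzRingType) (A A' : tensor F) : A =1 A' -> invS A = invS A'.
Proof. by move=> AA'; apply: optrace_ext. Qed.

Lemma invT_ext (F : comNzRingType) (A A' : tensor F) : A =1 A' -> invT A = invT A'.
Proof.
move=> AA'; apply: optrace_ext => // i; apply/matrixP => p q; rewrite !mxE.
by apply: eq_bigr => x _; apply: eq_bigr => y _; rewrite !AA'.
Qed.

(** * Base change of the invariants along ring morphisms *)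

Section Map.
Variables (F F' : comNzRingType) (f : {rmorphism F -> F'}).

Definition map_tensor (A : tensor F) : tensor F' := fun i => map_mx f (A i).

Lemma map_mixadj X Y : mixadj (map_mx f X) (map_mx f Y) = map_mx f (mixadj X Y).
Proof. by apply/matrixP => i j; rewrite !mxE !rmorphB !rmorphD /= !rmorphM. Qed.

Lemma map_optrace (A B C D : tensor F) :
  optrace (map_tensor A) (map_tensor B) (map_tensor C) (map_tensor D) =
  f (optrace A B C D).
Proof.
rewrite !optraceE rmorph_sum; apply: eq_bigr => i _.
rewrite rmorph_sum; apply: eq_bigr => j _.
rewrite rmorph_sum; apply: eq_bigr => a _.
rewrite rmorph_sum; apply: eq_bigr => b _.
by rewrite rmorphM /= !map_mixadj !mxE.
Qed.

Lemma map_hess A : hess (map_tensor A) =1 map_tensor (hess A).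
Proof.
move=> i; apply/matrixP => j k; rewrite !mxE.
rewrite rmorph_sum; apply: eq_bigr => a _.
rewrite rmorph_sum; apply: eq_bigr => b _.
by rewrite rmorphM /= !map_mixadj !mxE.
Qed.

Lemma map_invS A : invS (map_tensor A) = f (invS A).
Proof. exact: map_optrace. Qed.

Lemma map_invT A : invT (map_tensor A) = f (invT A).
Proof.
rewrite /invT -map_optrace; apply: optrace_ext => //; exact: map_hess.
Qed.
End Map.

(** * The valuation ring of the Puiseux series *)

Section ValuationRing.
Variable F : fieldType.
Local Notation K := (puiseux F).
Implicit Types x y : K.

Lemma pcoefD x y q : (x + y) q = x q + y q. Proof. by []. Qed.
Lemma pcoefN x q : (- x) q = - x q. Proof. by []. Qed.
Lemma pcoef1 q : (1 : K) q = (q == 0)%:R.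
Proof. by rewrite /=; case: eqP. Qed.

(** The case in which a single splitting of the exponent contributes; it covers products with a
    monomial and constant terms of integral series. *)
Lemma pcoefM1 x y q r :
  (forall p, p != r -> x p * y (q - p) = 0) -> (x * y) q = x r * y (q - r).
Proof.
move=> xy0; rewrite /= /mulcoef (fsbigE [:: r]) //.
  by rewrite big_cons big_nil in_setT; apply: addr0.
by move=> p _; rewrite inE => pr; apply: xy0.
Qed.

Lemma pcoef_mono c r x q : (pmono c r * x) q = c * x (q - r).
Proof.
rewrite (@pcoefM1 _ _ _ r) /= ?eqxx // => p /negPf pr.
by rewrite pr mul0r.
Qed.

Lemma pmonoM c d q r : pmono c q * pmono d r = pmono (c * d) (q + r) :> K.
Proof.
apply: puiseuxP => p; rewrite pcoef_mono /= subr_eq [q + r]addrC.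
by case: eqP => // _; rewrite mulr0.
Qed.

(** The valuation ring, with nonnegative valuation expressed through coefficients. *)
Definition pintegral : pred K := fun x => `[< forall q, q < 0 -> x q = 0 >].

Lemma pintegralP x : reflect (forall q, q < 0 -> x q = 0) (x \in pintegral).
Proof. exact: asboolP. Qed.

Lemma pcoef_integralM x y : x \in pintegral -> y \in pintegral ->
  (x * y) 0 = x 0 * y 0.
Proof.
move=> /pintegralP x0 /pintegralP y0; rewrite (@pcoefM1 _ _ _ 0) ?subr0 // => p.
rewrite neq_lt => /orP[p0|p0].
  by rewrite (x0 p p0) mul0r.
by rewrite (y0 (0 - p)) ?mulr0 // sub0r oppr_lt0.
Qed.

Fact pintegral_subring : subring_closed pintegral.
Proof.
split=> [|x y /pintegralP x0 /pintegralP y0|x y /pintegralP x0 /pintegralP y0];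
  apply/pintegralP => q q0.
- by rewrite pcoef1 lt_eqF.
- by rewrite pcoefD pcoefN x0 // y0 // subr0.
rewrite (@pcoefM1 _ _ _ 0) ?(x0 q) ?subr0 ?(y0 q) ?mulr0 //.
move=> p _; have [p0|p0] := ltP p 0; first by rewrite (x0 p) ?mul0r.
by rewrite (y0 (q - p)) ?mulr0 // subr_lt0 (lt_le_trans q0).
Qed.
HB.instance Definition _ := GRing.isSubringClosed.Build K pintegral pintegral_subring.

Record pint := PInt { pint_val :> K; pint_valP : pint_val \in pintegral }.
HB.instance Definition _ := [isSub for pint_val].
HB.instance Definition _ := [Choice of pint by <:].
HB.instance Definition _ := [SubChoice_isSubComNzRing of pint by <:].

Definition residue (x : pint) : F := (x : K) 0.

Fact residue_is_zmod_morphism : zmod_morphism residue.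
Proof. by []. Qed.
HB.instance Definition _ :=
  GRing.isZmodMorphism.Build pint F residue residue_is_zmod_morphism.

Fact residue_is_monoid_morphism : monoid_morphism residue.
Proof.
split=> [|x y]; first by rewrite /residue [LHS]pcoef1 eqxx.
by rewrite /residue [LHS]pcoef_integralM ?pint_valP.
Qed.
HB.instance Definition _ :=
  GRing.isMonoidMorphism.Build pint F residue residue_is_monoid_morphism.

Lemma pval_gt0 x : (0 < pval x)%E ->
  x \in pintegral /\ x 0 = 0.
Proof.
have [->|x0] := eqVneq x 0; first by rewrite rpred0.
have [q [-> _ qmin]] := pvalP x0; rewrite lte_fin => q_gt0.
have x_le0 p : p <= 0 -> x p = 0.
  move=> p0; apply/eqP; apply: contraTT p0 => /qmin.
  by rewrite -ltNge; apply: lt_le_trans.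
by split; [apply/pintegralP => p /ltW|]; apply: x_le0.
Qed.

End ValuationRing.

(** * Convex geometry of the subdivision *)

(* The lattice points of the triangle other than (1,1). *)
Definition rim : seq (nat * nat) :=
  [:: (0, 0); (1, 0); (2, 0); (3, 0); (0, 1); (2, 1); (0, 2); (1, 2); (0, 3)]%N.

(** The open half-plane with inner normal u whose boundary line passes through (1,1). *)
Definition above (u : int * int) (v : nat * nat) : bool :=
  u.1 + u.2 < u.1 * v.1%:Z + u.2 * v.2%:Z.

(** The point (1,1) as barycenter of v1, v2, v3 with weights n, denominators cleared. *)
Definition centered (v1 v2 v3 : nat * nat) (n : nat * nat * nat) : bool :=
  let: (n1, n2, n3) := n in
  [&& n1 * v1.1 + n2 * v2.1 + n3 * v3.1 == n1 + n2 + n3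
    & n1 * v1.2 + n2 * v2.2 + n3 * v3.2 == n1 + n2 + n3]%N.

Definition directions : seq (int * int) :=
  let r := [:: -4; -3; -2; -1; 0; 1; 2; 3; 4] in [seq (a, b) | a <- r, b <- r].
Definition weights : seq (nat * nat * nat) :=
  let r := [:: 1; 2; 3]%N in
  [seq (ab, c) | ab <- [seq (a, b) | a <- r, b <- r], c <- r].

Definition separable (s : seq (nat * nat)) : bool :=
  has (fun u => all (above u) s) directions.
Definition surrounds (s : seq (nat * nat)) : bool :=
  has (fun v1 => has (fun v2 =>
    has (fun v3 => has (centered v1 v2 v3) weights) s) s) s.

Fixpoint subseqs (s : seq (nat * nat)) : seq (seq (nat * nat)) :=
  if s is x :: s' then let r := subseqs s' in map (cons x) r ++ r else [:: [::]].

Lemma filter_subseqs (Z : pred (nat * nat)) s : filter Z s \in subseqs s.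
Proof.
elim: s => //= x s IH; rewrite mem_cat; case: (Z x); last by rewrite IH orbT.
by rewrite map_f.
Qed.

(* Gordan's alternative for the 2^9 subsets of rim; the directions and weights
   listed above suffice for all of them. *)
Lemma rim_alternative (Z : pred (nat * nat)) :
  separable (filter Z rim) \/ surrounds (filter Z rim).
Proof.
have : all (fun s => if separable s then true else surrounds s) (subseqs rim).
  by vm_compute.
move=> /allP/(_ _ (filter_subseqs Z rim)).
by case: ifP => [|_]; [left|right].
Qed.

Section Convexity.
Variable R : realType.

Lemma convex_comb (M : lmodType R) (D : set M) x y (t : R) :
  @convex_set R M D -> D x -> D y -> 0 <= t <= 1 -> D (t *: x + (1 - t) *: y).
Proof.
move=> cD Dx Dy /andP[t0 t1].
by have := cD x y (Itv01 t0 t1) (mem_set Dx) (mem_set Dy); rewrite in_setE.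
Qed.

Lemma convexI (M : lmodType R) (D : set M) :
  (forall x y (t : R), D x -> D y -> 0 <= t <= 1 -> D (t *: x + (1 - t) *: y)) ->
  @convex_set R M D.
Proof.
move=> cD x y t; rewrite !in_setE => Dx Dy; apply: (cD _ _ t%:num) => //.
by rewrite ge0 le1.
Qed.

Lemma hull_sub (M : lmodType R) (A : set M) x : A x -> hull A x.
Proof. exact: sub_gen_smallest. Qed.

Lemma hull_min (M : lmodType R) (A D : set M) :
  @convex_set R M D -> (forall x, A x -> D x) -> forall x, hull A x -> D x.
Proof. by move=> cD AD; apply: smallest_sub. Qed.

Lemma hull_convex (M : lmodType R) (A : set M) : @convex_set R M (hull A).
Proof.
apply: convexI => x y t Ax Ay t01 D [cD AD].
by apply: convex_comb => //; [apply: Ax|apply: Ay].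
Qed.

Lemma convex_comb3 (M : lmodType R) (D : set M) x y z (a b c : R) :
  @convex_set R M D -> D x -> D y -> D z -> 0 <= a -> 0 < b -> 0 < c ->
  a + b + c = 1 -> D (a *: x + (b *: y + c *: z)).
Proof.
move=> cD Dx Dy Dz a0 b0 c0 abc; have bc : b + c != 0 by rewrite gt_eqF ?addr_gt0.
have aE : 1 - a = b + c by rewrite -abc; ring.
have -> : b *: y + c *: z =
    (1 - a) *: ((b / (b + c)) *: y + (1 - b / (b + c)) *: z).
  by rewrite scalerDr !scalerA; congr (_ *: _ + _ *: _); rewrite aE; field.
have t01 : 0 <= b / (b + c) <= 1.
  rewrite divr_ge0 ?addr_ge0 ?(ltW b0) ?(ltW c0) //= ler_pdivrMr ?addr_gt0 //.
  by rewrite mul1r lerDl ltW.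
apply: convex_comb => //; first by apply: convex_comb.
by rewrite a0 -abc -addrA lerDl addr_ge0 ?ltW.
Qed.

(** Turns strict inequalities at finitely many points into one uniform margin, which later
    perturbations of affine functions may use up. *)
Lemma positive_bound (T : eqType) (s : seq T) (P : T -> Prop) (f : T -> R) :
  (forall x, P x -> 0 < f x) ->
  exists2 e, 0 < e & forall x, x \in s -> P x -> e <= f x.
Proof.
move=> f_gt0; elim: s => [|x s [e e0 es]]; first by exists 1.
have [Px|nPx] := pselect (P x); last first.
  by exists e => // y; rewrite inE => /orP[/eqP->|/es].
exists (Num.min e (f x)); first by rewrite lt_min e0 f_gt0.
move=> y; rewrite inE ge_min => /orP[/eqP->|ys Py]; first by rewrite lexx orbT.
by rewrite es.
Qed.

End Convexity.

(** * From a cycle to an affine function touching the heights only at (1,1) *)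

Section TropicalCycle.
Variable R : realType.
Local Notation plane := 'rV[R]_2.
Variable w : 'X_{1..2} -> \bar R.
Local Notation pt := (@lattice_pt R).

Definition mn (ab : nat * nat) : 'X_{1..2} := [multinom [tuple ab.1; ab.2]].
Definition triangle : seq (nat * nat) := (1, 1)%N :: rim.

Hypothesis w_triangle : forall m, trop_supp w m ->
  exists2 v, v \in triangle & m = mn v.

Definition aff (u1 u2 c : R) (x : plane) : R :=
  x 0 ord0 * u1 + x 0 ord_max * u2 + c.

Lemma aff_comb u1 u2 c x y (t : R) : aff u1 u2 c (t *: x + (1 - t) *: y) =
  t * aff u1 u2 c x + (1 - t) * aff u1 u2 c y.
Proof. by rewrite /aff !mxE; ring. Qed.

Lemma aff_pt u1 u2 c v :
  aff u1 u2 c (pt (mn v)) = v.1%:R * u1 + v.2%:R * u2 + c.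
Proof. by rewrite /aff !mxE. Qed.

Definition supports u1 u2 c :=
  forall m, trop_supp w m -> ((aff u1 u2 c (pt m))%:E <= w m)%E.

Lemma supports_hull u1 u2 c x a :
  supports u1 u2 c -> hull (lifted_points w) (x, a) -> aff u1 u2 c x <= a.
Proof.
move=> sup.
pose D : set (plane * R^o) := [set xa | aff u1 u2 c xa.1 <= xa.2]%classic.
move=> xa; suff : D (x, a) by [].
apply: hull_min xa => [|[y b] [m [mS /= -> wm]]].
  apply: convexI => -[y b] [z d] t; rewrite /D /= => yb zd /andP[t0 t1].
  rewrite aff_comb lerD // ler_wpM2l //.
  by rewrite subr_ge0.
by rewrite /D /= -lee_fin (le_trans (sup m mS)).
Qed.

Lemma newton_lift x :
  newton_polygon w x -> exists a, hull (lifted_points w) (x, a).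
Proof.
apply: (@hull_min _ _ _ [set x | exists a, hull (lifted_points w) (x, a)]%classic).
  apply: convexI => y z t [b yb] [d zd] t01; exists (t *: b + (1 - t) *: d).
  exact: (convex_comb (@hull_convex _ _ _) yb zd t01).
move=> _ [m mS <-]; exists (fine (w m)); apply: hull_sub.
by exists m; split=> //=; rewrite fineK.
Qed.

(** The support is finite, so the heights are bounded below; this makes the infimum in [LC] a
    genuine one. *)
Lemma supports_cst : exists c, supports 0 0 c.
Proof.
(* A positive lower bound e for 1 / (1 + |w m|) bounds |w m| above by 1/e. *)
have [e e0 eP] := @positive_bound R _ (map mn triangle) (fun=> True)
  (fun m => 1 / (1 + `|fine (w m)|))
  (fun m _ => divr_gt0 ltr01 (ltr_pwDl ltr01 (normr_ge0 _))).
exists (- e^-1) => m mS; have [v vt mE] := w_triangle mS.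
rewrite /aff !mulr0 !add0r -(fineK mS) lee_fin.
have := eP m; rewrite mE map_f // => /(_ isT I).
rewrite ler_pdivlMr ?ltr_pwDl // -ler_pdivlMl // mulr1 => h.
by rewrite lerNl; apply: le_trans h; rewrite (le_trans (ler_norm _)) // normrN lerDr.
Qed.

Lemma LC_le x a : hull (lifted_points w) (x, a) -> LC w x <= a.
Proof.
move=> xa; apply: ge_inf => //; have [c cS] := supports_cst.
by exists (aff 0 0 c x) => b; apply: supports_hull.
Qed.

(** The infimum is only approximated: whether the hull attains it is left open. *)
Lemma LC_lt x e : newton_polygon w x -> 0 < e ->
  exists2 a, hull (lifted_points w) (x, a) & a < LC w x + e.
Proof.
move=> /newton_lift[a xa] e0; apply: inf_adherent => //; split; first by exists a.
have [c cS] := supports_cst.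
by exists (aff 0 0 c x) => b; apply: supports_hull.
Qed.

Lemma supports_LC u1 u2 c x : supports u1 u2 c -> newton_polygon w x ->
  aff u1 u2 c x <= LC w x.
Proof.
move=> sup /newton_lift[a xa]; apply: lb_le_inf; first by exists a.
by move=> b; apply: supports_hull.
Qed.

Lemma LC_convex x y t : newton_polygon w x -> newton_polygon w y ->
  0 <= t <= 1 -> LC w (t *: x + (1 - t) *: y) <= t * LC w x + (1 - t) * LC w y.
Proof.
move=> Nx Ny t01; apply/ler_addgt0Pr => e e0.
have [a xa ae] := LC_lt Nx e0; have [b yb be] := LC_lt Ny e0.
apply: (le_trans (LC_le (convex_comb (@hull_convex _ _ _) xa yb t01))).
case/andP: t01 => t0 t1; have t1' : 0 <= 1 - t by rewrite subr_ge0.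
have := ler_wpM2l t0 (ltW ae); have := ler_wpM2l t1' (ltW be).
move=> h1 h2; rewrite [leRHS](_ : _ = t * (LC w x + e) + (1 - t) * (LC w y + e)).
  exact: lerD.
by ring.
Qed.

Lemma newton_pt m : trop_supp w m -> newton_polygon w (pt m).
Proof. by move=> mS; apply: hull_sub; exists m. Qed.

Lemma LC_pt m : trop_supp w m -> ((LC w (pt m))%:E <= w m)%E.
Proof.
move=> mS; rewrite -(fineK mS) lee_fin; apply: LC_le; apply: hull_sub.
by exists m; split=> //=; rewrite fineK.
Qed.

(* As Q has interior points, convexity puts LC above the affine function that it
   equals on Q; by maximality Q is the whole contact set. *)
Lemma domain_support Q : linearity_domain w Q -> two_dimensional Q ->
  (forall D, linearity_domain w D -> (Q `<=` D)%classic -> D = Q) ->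
  exists u1 u2 c, supports u1 u2 c /\
    forall x, Q x <-> newton_polygon w x /\ LC w x <= aff u1 u2 c x.
Proof.
move=> [QN cQ [u [c uE]]] [q0 [q1 [q2 [Qq0 Qq1 Qq2 free]]]] Qmax.
pose l := aff (u ord0 0) (u ord_max 0) c.
have LCl x : Q x -> LC w x = l x.
  move=> /uE ->; rewrite mxE !big_ord_recl big_ord0 addr0 /l /aff.
  by congr (_ + _ * u _ _ + _); [congr (x _ _)|]; apply: val_inj.
have leLC y : newton_polygon w y -> l y <= LC w y.
  (* z is the barycenter of a triangle inside Q. A small step from z towards y stays in Q, where
     [LC] equals l, and convexity along the segment carries the inequality to y. *)
  move=> Ny; pose z := 3%:R^-1 *: q0 + (3%:R^-1 *: q1 + 3%:R^-1 *: q2).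
  have [al [be yzE]] : exists al be, y - z = al *: (q1 - q0) + be *: (q2 - q0).
    have /submxP[k ->] : (y - z <= col_mx (q1 - q0) (q2 - q0))%MS.
      by rewrite submx_full // row_full_unit -row_free_unit.
    exists (lsubmx k 0 0), (rsubmx k 0 0); rewrite -[k in LHS]hsubmxK mul_row_col.
    by rewrite -!mul_scalar_mx -!mx11_scalar.
  (* With this e, the weights 1/3 + e al and 1/3 + e be are at least 1/6, and 1/3 - e al - e be is
     nonnegative. *)
  pose e := (6%:R * (1 + `|al| + `|be|))^-1.
  have e0 : 0 < e by rewrite invr_gt0 mulr_gt0 ?ltr_pwDl // ltr_pwDl // addr_gt0.
  have eE : e * (1 + `|al| + `|be|) = 6%:R^-1.
    rewrite /e; field; rewrite gt_eqF // -addrA ltr_pwDl ?addr_ge0 //.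
  have e_al : `|e * al| <= 6%:R^-1.
    rewrite normrM gtr0_norm // -eE ler_pM2l //.
    by rewrite [1 + _]addrC -addrA lerDl addr_ge0.
  have e_be : `|e * be| <= 6%:R^-1.
    rewrite normrM gtr0_norm // -eE ler_pM2l //.
    by rewrite lerDr addr_ge0.
  move: e_al e_be; rewrite !ler_norml => /andP[al1 al2] /andP[be1 be2].
  have Qz : Q z by apply: convex_comb3 => //; lra.
  have Qx : Q (e *: y + (1 - e) *: z).
    have -> : e *: y + (1 - e) *: z = (3%:R^-1 - e * al - e * be) *: q0
        + ((3%:R^-1 + e * al) *: q1 + (3%:R^-1 + e * be) *: q2).
      rewrite -[y](subrK z) yzE; apply/rowP => i; rewrite /z !mxE; ring.
    apply: convex_comb3 => //; lra.
  have e1 : e <= 1.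
    have : e * 1 <= 6%:R^-1 by rewrite -eE ler_pM2l // -addrA lerDl addr_ge0.
    lra.
  have := LC_convex Ny (QN _ Qz) (introT andP (conj (ltW e0) e1)).
  rewrite (LCl _ Qx) /l aff_comb -!/(l _) (LCl _ Qz) lerD2r ler_pM2l //.
exists (u ord0 0), (u ord_max 0), c; split.
  by move=> m mS; apply: le_trans (LC_pt mS); rewrite lee_fin leLC //; exact: newton_pt.
pose D : set plane := [set x | newton_polygon w x /\ LC w x <= l x]%classic.
suff <- : D = Q by [].
apply: Qmax; last by move=> x Qx; split; [apply: QN|rewrite LCl].
have cD : @convex_set R plane D.
  apply: convexI => x y t [Nx lx] [Ny ly] t01; split.
    exact: (convex_comb (@hull_convex _ _ _)).
  apply: (le_trans (LC_convex Nx Ny t01)); rewrite /l aff_comb.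
  by case/andP: t01 => t0 t1; rewrite lerD // ler_wpM2l // subr_ge0.
split=> [x []//|//|]; exists u, c => x [Nx lx].
have -> : (x *m u) 0 0 + c = l x.
  rewrite mxE !big_ord_recl big_ord0 addr0 /l /aff.
  by congr (_ + _ * u _ _ + _); [congr (x _ _)|]; apply: val_inj.
by apply/eqP; rewrite eq_le lx leLC.
Qed.

Lemma pt_inj v v' : pt (mn v) = pt (mn v') -> v = v'.
Proof.
case: v v' => [a b] [a' b'] E.
have coord i : mn (a, b) i = mn (a', b') i.
  have := congr1 (fun x : plane => x 0 i) E; rewrite !mxE => /eqP.
  by rewrite eqr_nat => /eqP.
by rewrite (coord ord0 : a = a') (coord ord_max : b = b').
Qed.

(** All weights are positive, so (1,1) lies strictly between v1 and a point of the segment from v2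
    to v3, both in Q; being a vertex, it equals v1. *)
Lemma vertex_surrounds Q (s : seq (nat * nat)) : @convex_set R plane Q ->
  vertex Q (pt (mn (1, 1)%N)) -> (forall v, v \in s -> Q (pt (mn v))) ->
  surrounds s -> (1, 1)%N \in s.
Proof.
move=> cQ [_ Qv] sQ /hasP[v1 v1s /hasP[v2 v2s /hasP[v3 v3s /hasP[[[n1 n2] n3]]]]].
move=> nw /andP[/eqP E1 /eqP E2].
have [n10 n20 n30] : [/\ 0 < n1, 0 < n2 & 0 < n3]%N.
  move: nw; clear; rewrite /weights /= !inE !xpair_eqE.
  by do ![case/orP] => /andP[/andP[/eqP -> /eqP ->] /eqP ->].
have pos n : (0 < n)%N -> 0 < n%:R :> R by rewrite ltr0n.
have := pos _ n10; have := pos _ n20; have := pos _ n30 => p3 p2 p1.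
have nz1 : n1%:R + n2%:R + n3%:R != 0 :> R by rewrite gt_eqF ?addr_gt0.
have nz2 : n2%:R + n3%:R != 0 :> R by rewrite gt_eqF ?addr_gt0.
pose t : R := n1%:R / (n1%:R + n2%:R + n3%:R).
pose k : R := n2%:R / (n2%:R + n3%:R).
have k01 : 0 <= k <= 1.
  rewrite divr_ge0 ?addr_ge0 ?ler0n //= ler_pdivrMr ?addr_gt0 //.
  by rewrite mul1r lerDl ler0n.
have t01 : 0 < t < 1.
  rewrite divr_gt0 ?addr_gt0 //= ltr_pdivrMr ?addr_gt0 //.
  by rewrite mul1r -addrA ltrDl addr_gt0.
have Qr : Q (k *: pt (mn v2) + (1 - k) *: pt (mn v3)).
  by apply: convex_comb => //; apply: sQ.
have E : pt (mn (1, 1)%N) =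
    t *: pt (mn v1) + (1 - t) *: (k *: pt (mn v2) + (1 - k) *: pt (mn v3)).
  have coord (a1 a2 a3 : nat) : (n1 * a1 + n2 * a2 + n3 * a3 = n1 + n2 + n3)%N ->
      1 = t * a1%:R + (1 - t) * (k * a2%:R + (1 - k) * a3%:R).
    move=> /(congr1 (fun n => n%:R : R)); rewrite !natrD !natrM => Ea.
    apply: (mulfI nz1); rewrite mulr1 -[in LHS]Ea /t /k; field.
    by rewrite nz1 nz2.
  apply/rowP => i; rewrite !mxE; case: i => -[|[|//]] i2 /=; exact: coord.
have [/pt_inj <- _] := Qv _ _ _ (sQ _ v1s) Qr t01 E.
by [].
Qed.

(** Let l be the affine function of the cell Q. Its contact points on the rim cannot surround the
    vertex (1,1), so by Gordan's alternative a line through (1,1) has them strictly on one side.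
    Tilting l slightly about (1,1) removes those contacts. *)
Lemma cycle_exposed : has_cycle w ->
  trop_supp w (mn (1, 1)%N) /\ exists u1 u2 : R, forall v, v \in rim ->
    trop_supp w (mn v) ->
    fine (w (mn (1, 1)%N)) + (v.1%:R - 1) * u1 + (v.2%:R - 1) * u2
      < fine (w (mn v)).
Proof.
move=> [[Q A] [/= linQ Qmax dimQ _] Qv].
have [u1 [u2 [c [sup supQ]]]] := domain_support linQ dimQ Qmax.
have [QN cQ _] := linQ; have Qp : Q (pt (mn (1, 1)%N)) := Qv.1.
pose l v := aff u1 u2 c (pt (mn v)).
have lE v : l v = v.1%:R * u1 + v.2%:R * u2 + c by exact: aff_pt.
pose Z v := trop_supp w (mn v) /\ fine (w (mn v)) = l v.
have ZQ v : Z v -> Q (pt (mn v)).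
  move=> [vS wE]; apply/supQ; split; first exact: newton_pt.
  by rewrite -lee_fin -/(l v) -wE fineK //; apply: LC_pt.
have l_le v : trop_supp w (mn v) -> l v <= fine (w (mn v)).
  by move=> vS; rewrite -lee_fin fineK //; apply: sup.
have [sep|sur] := rim_alternative (fun v => `[< Z v >]); last first.
  have : (1, 1)%N \in [seq v <- rim | `[< Z v >]].
    apply: vertex_surrounds cQ Qv _ sur => v.
    by rewrite mem_filter => /andP[/asboolP Zv _]; apply: ZQ.
  by rewrite mem_filter andbF.
have [[a b] _ /allP abP] := hasP sep.
pose phi (v : nat * nat) : R := a%:~R * (v.1%:R - 1) + b%:~R * (v.2%:R - 1).
(* [phi] takes integral values on lattice points, so positive means at least 1. *)
have phi1 v : v \in rim -> Z v -> 1 <= phi v.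
  move=> vr /asboolP Zv.
  have := abP v; rewrite mem_filter Zv vr /above /= => /(_ isT).
  rewrite -lezD1 -(ler_int R) !intrD !intrM -!pmulrn /phi => h.
  rewrite -subr_ge0 in h; rewrite -subr_ge0; move: h; congr (0 <= _); ring.
(* Tilting by e costs at most e |phi v| at v; the summand 1 reserves a further e, for the lift or
   for strictness. *)
have [|e e0 eP] := @positive_bound R _ triangle
  (fun v => trop_supp w (mn v) /\ ~ Z v)
  (fun v => (fine (w (mn v)) - l v) / (1 + `|phi v|)).
  move=> v [vS nZ]; apply: divr_gt0; last by rewrite ltr_pwDl.
  rewrite subr_gt0 lt_neqAle l_le // andbT.
  by apply/eqP => lw; apply: nZ; split.
have {}eP v : v \in triangle -> trop_supp w (mn v) -> ~ Z v ->
    e * (1 + `|phi v|) <= fine (w (mn v)) - l v.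
  by move=> vt vS nZ; rewrite -ler_pdivlMr ?ltr_pwDl //; apply: eP.
have phip : phi (1, 1)%N = 0 by rewrite /phi /= !subrr !mulr0 addr0.
(* The term e (a + b) centres the tilt at (1,1), where [phi] vanishes; the last e is the lift. *)
pose c' := c + e * (a%:~R + b%:~R) + e.
have affE v : aff (u1 - e * a%:~R) (u2 - e * b%:~R) c' (pt (mn v)) =
    l v - e * phi v + e.
  by rewrite aff_pt lE /phi /c'; ring.
have [Zp|nZp] := pselect (Z (1, 1)%N); last first.
  (* Tilting l along phi and raising it by e keeps it below the heights, so LC
     would exceed l at (1, 1). *)
  have sup' : supports (u1 - e * a%:~R) (u2 - e * b%:~R) c'.
    move=> m mS; have [v vt mE] := w_triangle mS.
    rewrite mE affE -mE -(fineK mS) lee_fin mE.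
    rewrite mE in mS; have [Zv|nZv] := pselect (Z v).
      have vr : v \in rim.
        by move: vt; rewrite inE => /orP[/eqP vE|//]; case: nZp; rewrite -vE.
      have := ler_wpM2l (ltW e0) (phi1 v vr Zv).
      by rewrite (Zv.2); lra.
    have := eP v vt mS nZv; have := ler_wpM2l (ltW e0) (ler_norm (- phi v)).
    by rewrite normrN; lra.
  have := supports_LC sup' (QN _ Qp); rewrite affE phip.
  have lcp : LC w (pt (mn (1, 1)%N)) <= l (1, 1)%N.
    by have [] := (supQ _).1 Qp.
  lra.
split; first exact: Zp.1.
exists (u1 - e * a%:~R), (u2 - e * b%:~R) => v vr vS; rewrite Zp.2 lE /=.
have -> : 1 * u1 + 1 * u2 + c + (v.1%:R - 1) * (u1 - e * a%:~R) +
    (v.2%:R - 1) * (u2 - e * b%:~R) = l v - e * phi v by rewrite lE /phi; ring.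
have [Zv|nZv] := pselect (Z v).
  have := ler_wpM2l (ltW e0) (phi1 v vr Zv).
  by rewrite (Zv.2); lra.
have := eP v _ vS nZv; rewrite inE vr orbT => /(_ isT).
have := ler_wpM2l (ltW e0) (ler_norm (- phi v)).
by rewrite normrN; lra.
Qed.

(** The slopes become exponents of t, which have to be rational. *)
Lemma cycle_exposed_rat : has_cycle w ->
  trop_supp w (mn (1, 1)%N) /\ exists q1 q2 : rat, forall v, v \in rim ->
    trop_supp w (mn v) ->
    fine (w (mn (1, 1)%N)) + ratr ((v.1%:R - 1) * q1 + (v.2%:R - 1) * q2)
      < fine (w (mn v)).
Proof.
move=> /cycle_exposed[wp [u1 [u2 uP]]]; split=> //.
have [|e e0 eP] := @positive_bound R _ rim
  (fun v => v \in rim /\ trop_supp w (mn v))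
  (fun v => fine (w (mn v)) -
    (fine (w (mn (1, 1)%N)) + (v.1%:R - 1) * u1 + (v.2%:R - 1) * u2)).
  by move=> v [vr vS]; rewrite subr_gt0; apply: uP.
(* On the rim |v.1 - 1| + |v.2 - 1| is at most 3, so errors below e/8 in both slopes cost at most
   3e/8, less than the margin e. *)
have approx (u : R) : exists q : rat, u - e / 8%:R < ratr q < u + e / 8%:R.
  have [|q] := @rat_in_itvoo R (u - e / 8%:R) (u + e / 8%:R); first lra.
  by rewrite in_itv /= => qP; exists q.
have [q1 /andP[q1l q1r]] := approx u1; have [q2 /andP[q2l q2r]] := approx u2.
exists q1, q2 => v vr vS; have := eP v vr (conj vr vS).
rewrite rmorphD !rmorphM !rmorphB !rmorph1 !rmorph_nat.
by move: vr; rewrite !inE; do ![case/orP] => /eqP -> /=; lra.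
Qed.

End TropicalCycle.

(** * Plane cubics and their tensors *)

Section CubicForms.
Variable F : comNzRingType.
Implicit Types (A : tensor F) (u v w : 'I_3 -> F).

Definition tri A u v w : F :=
  \sum_i \sum_j \sum_k u i * v j * w k * A i j k.

Definition cform A v : F := tri A v v v.

(** Twice the gradient of the cubic with third derivatives A, just as [cform] is six times that
    cubic. *)
Definition grad A v : 'rV[F]_3 := \row_i \sum_j \sum_k v j * v k * A i j k.

Definition mxapp (M : 'M[F]_3) v : 'I_3 -> F := fun i => \sum_j M i j * v j.

Lemma form_symt c v : cform (symt c) v = 6%:R * \sum_(ab <- triangle)
  c ab.1 ab.2 * (v o0 ^+ ab.1 * v o1 ^+ ab.2 * v o2 ^+ (3 - (ab.1 + ab.2))).
Proof.
rewrite /cform /tri !sum3E !symtE /triangle !big_cons big_nil /=.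
ring.
Qed.

(** Polarization: where 6 is cancellable, the values of the cubic form determine its tensor. *)
Lemma tri_symt c u v w : 6%:R * tri (symt c) u v w =
  cform (symt c) (fun i => u i + v i + w i)
  - cform (symt c) (fun i => u i + v i) - cform (symt c) (fun i => u i + w i)
  - cform (symt c) (fun i => v i + w i)
  + cform (symt c) u + cform (symt c) v + cform (symt c) w.
Proof. by rewrite /cform /tri !sum3E !symtE; ring. Qed.

Lemma tri_mx A u v w :
  tri A u v w = (\row_j v j *m (\sum_i u i *: A i) *m \col_k w k) 0 0.
Proof. by rewrite /tri !(mxE, sum3E); ring. Qed.

Lemma act_tri M A u v w :
  tri (act M A) u v w = tri A (mxapp M u) (mxapp M v) (mxapp M w).
Proof.
rewrite !tri_mx.
have -> : \row_j mxapp M v j = \row_j v j *m M^T.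
  by apply/rowP => j; rewrite !mxE; apply: eq_bigr => k _; rewrite !mxE mulrC.
have -> : \col_j mxapp M w j = M *m \col_k w k.
  by apply/colP => j; rewrite !mxE; apply: eq_bigr => k _; rewrite !mxE.
have -> : \sum_i u i *: act M A i = M^T *m (\sum_p mxapp M u p *: A p) *m M.
  under eq_bigr do rewrite /act scalemxAl scalemxAr.
  rewrite -mulmx_suml -mulmx_sumr; congr (_ *m _ *m _).
  under eq_bigr do rewrite scaler_sumr.
  rewrite exchange_big; apply: eq_bigr => p _ /=; rewrite scaler_suml.
  by apply: eq_bigr => i _; rewrite scalerA mulrC.
by rewrite !mulmxA.
Qed.

Lemma tri_delta A i j k :
  tri A (fun a => (a == i)%:R) (fun a => (a == j)%:R) (fun a => (a == k)%:R) =
  A i j k.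
Proof.
rewrite /tri (bigD1 i) //= (bigD1 j) //= (bigD1 k) //= !eqxx !mul1r.
rewrite big1 => [|c /negPf ->]; last by rewrite mulr0 mul0r.
rewrite big1 => [|c /negPf ->]; last by rewrite big1 // => *; rewrite mulr0 !mul0r.
rewrite big1 => [|c /negPf ->]; last first.
  by rewrite big1 // => *; rewrite big1 // => *; rewrite !mul0r.
by rewrite !addr0.
Qed.

(** The chain rule for v -> M v. *)
Lemma grad_act M A v : grad (act M A) v = grad A (mxapp M v) *m M.
Proof.
apply/rowP => i; rewrite !mxE /mxapp.
under eq_bigr do under eq_bigr do rewrite actE.
under [RHS]eq_bigr do rewrite mxE.
by rewrite !sum3E; ring.
Qed.

(** Euler's relation; it places singular points on the curve. *)
Lemma form_grad A v : cform A v = \sum_i v i * grad A v 0 i.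
Proof.
apply: eq_bigr => i _; rewrite mxE mulr_sumr; apply: eq_bigr => j _.
by rewrite mulr_sumr; apply: eq_bigr => k _; rewrite !mulrA.
Qed.

End CubicForms.

Section PlaneCubics.
Variable K : fieldType.
Hypothesis char0 : forall n, (0 < n)%N -> n%:R != 0 :> K.
Implicit Types (f : {mpoly K[2]}) (v : 'I_3 -> K).

Lemma mn_inj : injective mn.
Proof.
move=> [a b] [a' b'] /mnmP E.
by rewrite (E ord0 : a = a') (E ord_max : b = b').
Qed.

Definition coefs f (a b : nat) : K := f@_(mn (a, b)).

Lemma supp_triangle f m : (msize f <= 4)%N -> m \in msupp f ->
  exists2 ab, ab \in triangle & m = mn ab.
Proof.
move=> f4 /msize_mdeg_lt mf; have := leq_trans mf f4.
have mE : m = mn (m ord0, m ord_max).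
  apply/mnmP => -[[|[|//]] i2]; rewrite multinomE (tnth_nth 0%N) /=; congr (m _);
    exact: val_inj.
rewrite mdegE !big_ord_recl big_ord0 /= addn0.
have -> : m (lift ord0 ord0) = m ord_max by congr (m _); apply: val_inj.
exists (m ord0, m ord_max) => //.
move: (m ord0) (m ord_max) H => [|[|[|[|a]]]] [|[|[|[|b]]]] //.
Qed.

Lemma sum_triangle f (h : 'X_{1..2} -> K) : (msize f <= 4)%N ->
  \sum_(m <- msupp f) f@_m * h m =
  \sum_(ab <- triangle) coefs f ab.1 ab.2 * h (mn ab).
Proof.
move=> f4; transitivity (\sum_(m <- map mn triangle) f@_m * h m); last first.
  by rewrite big_map; apply: eq_bigr => -[a b].
set T := map mn triangle.
rewrite [RHS](bigID (mem (msupp f))) /= [X in _ + X]big1 => [|m]; last first.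
  by move=> mf; rewrite memN_msupp_eq0 ?mul0r.
rewrite addr0 -[RHS]big_filter; apply: perm_big; apply: uniq_perm.
  exact: msupp_uniq.
  by rewrite filter_uniq // map_inj_uniq //; apply: mn_inj.
move=> m; rewrite mem_filter; apply/idP/andP => [mf|[]//]; split=> //.
by have [ab abt ->] := supp_triangle f4 mf; apply: map_f.
Qed.

Lemma prod3E (h : 'I_3 -> K) : \prod_i h i = h o0 * h o1 * h o2.
Proof.
rewrite !big_ord_recl big_ord0 mulr1 mulrA.
by congr (h _ * h _ * h _); apply: val_inj.
Qed.

Lemma ord3_eqE : ((o0 == o1) = false) * ((o0 == o2) = false) *
  ((o1 == o0) = false) * ((o1 == o2) = false) *
  ((o2 == o0) = false) * ((o2 == o1) = false).
Proof. by []. Qed.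

Definition homexp (m : 'X_{1..2}) : 'X_{1..3} :=
  [multinom [tuple m ord0; m ord_max; (3 - mdeg m)%N]].

Lemma homexpE a b : (homexp (mn (a, b)) o0 = a) * (homexp (mn (a, b)) o1 = b)
  * (homexp (mn (a, b)) o2 = 3 - (a + b))%N.
Proof.
split; first by [].
have -> : homexp (mn (a, b)) o2 = (3 - mdeg (mn (a, b)))%N by [].
by rewrite mdegE !big_ord_recl big_ord0 addn0.
Qed.

Lemma homogenize3_eval f v : (msize f <= 4)%N ->
  6%:R * (homogenize3 f).@[v] = cform (symt (coefs f)) v.
Proof.
move=> f4; rewrite form_symt; congr (_ * _).
rewrite /homogenize3 raddf_sum /=; under eq_bigr do rewrite mevalZ mevalX.
rewrite (@sum_triangle f (fun m => \prod_i v i ^+ homexp m i)) //.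
apply: eq_bigr => -[a b] _; congr (_ * _).
by rewrite prod3E !homexpE.
Qed.

Lemma homogenize3_grad f v i : (msize f <= 4)%N ->
  2%:R * ((homogenize3 f)^`M(i)).@[v] = grad (symt (coefs f)) v 0 i.
Proof.
move=> f4.
have -> : (homogenize3 f)^`M(i) = \sum_(m <- msupp f)
    f@_m *: ((homexp m i)%:R *: 'X_[homexp m - U_(i)]).
  rewrite [LHS](linear_sum (mderiv i)); apply: eq_bigr => m _.
  by rewrite [LHS]mderivZ; congr (_ *: _); apply: mderivX.
rewrite raddf_sum /=; under eq_bigr do rewrite !mevalZ mevalX.
rewrite (@sum_triangle f
  (fun m => (homexp m i)%:R * \prod_j v j ^+ (homexp m - U_(i))%MM j)) //.
under eq_bigr do rewrite prod3E !mnmBE !mnmE.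
rewrite mxE !sum3E /triangle !big_cons big_nil !homexpE /=.
by move: i; apply: ord3P; rewrite !homexpE !symtE !eqxx ?ord3_eqE /=
  !(addSn, add0n, subSS, subn0, sub0n); ring.
Qed.

End PlaneCubics.

(** * Comparison of a cubic with its Weierstrass form *)

Section WeierstrassForm.
Variable K : fieldType.
Hypothesis char0 : forall n, (0 < n)%N -> n%:R != 0 :> K.
Implicit Types (f : {mpoly K[2]}) (v : 'I_3 -> K).

Lemma weierstrass_eval a b v :
  6%:R * (weierstrass a b).@[v] = cform (symt (weic a b)) v.
Proof.
rewrite form_symt; congr (_ * _).
rewrite /weierstrass !(mevalB, mevalD, mevalM, mevalZ, rmorphXn) /= !mevalXU.
rewrite /triangle !big_cons big_nil /=.
have [-> -> ->] : [/\ (2 : 'I_3) = o2, (1 : 'I_3) = o1 & (0 : 'I_3) = o0].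
  by split; apply: val_inj.
ring.
Qed.

(** The polynomial identity is evaluated at every v and then polarized, which gives equality of
    tensors entry by entry. *)
Lemma proj_equiv_act f a b : (msize f <= 4)%N ->
  proj_equiv (homogenize3 f) (weierstrass a b) ->
  exists M c, [/\ M \in unitmx, c != 0 & forall i,
    act M (symt (coefs f)) i = c *: symt (weic a b) i].
Proof.
move=> f4 [M [c [M_unit c0 E]]]; exists M, c; split=> // i.
have formE v : cform (symt (coefs f)) (mxapp M v) = c * cform (symt (weic a b)) v.
  rewrite -homogenize3_eval // -weierstrass_eval [RHS]mulrCA; congr (_ * _).
  rewrite -mevalZ -E comp_mpoly_meval; apply: meval_eq => k.
  rewrite tnth_mktuple raddf_sum /=.
  by apply: eq_bigr => l _; rewrite mevalZ mevalXU.
have triE u v w : tri (symt (coefs f)) (mxapp M u) (mxapp M v) (mxapp M w) =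
    c * tri (symt (weic a b)) u v w.
  have char6 : 6%:R != 0 :> K by apply: char0.
  apply: (mulfI char6); rewrite [RHS]mulrCA !tri_symt.
  have mxappD u1 u2 : mxapp M (fun k => u1 k + u2 k) =
      fun k => mxapp M u1 k + mxapp M u2 k.
    apply/funext => k; rewrite /mxapp -big_split.
    by apply: eq_bigr => l _ /=; ring.
  have mxappD3 : (fun k => mxapp M u k + mxapp M v k + mxapp M w k) =
      mxapp M (fun k => u k + v k + w k) by rewrite !mxappD.
  by rewrite mxappD3 -!mxappD !formE; ring.
by apply/matrixP => j k; rewrite -tri_delta act_tri triE tri_delta [RHS]mxE.
Qed.

(** If the discriminant vanished, x^3 + a x + b would have a double root x, and M would carry the
    singular point (x : 0 : 1) of the Weierstrass cubic to a singular point of the given one. *)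
Lemma disc_neq0 f a b : (msize f <= 4)%N -> smooth_curve (homogenize3 f) ->
  proj_equiv (homogenize3 f) (weierstrass a b) ->
  4%:R * a ^+ 3 + 27%:R * b ^+ 2 != 0.
Proof.
move=> f4 smooth /(proj_equiv_act f4)[M [c [M_unit c0 actE]]].
have char2 := char0 (isT : 0 < 2)%N; have char6 := char0 (isT : 0 < 6)%N.
apply/eqP => disc0.
have [x [x1 x2]] : exists x, 3%:R * x ^+ 2 + a = 0 /\ x ^+ 3 + a * x + b = 0.
  have [a0|a0] := eqVneq a 0.
    exists 0; rewrite a0; move: disc0; rewrite a0 !expr0n /= !mulr0 !add0r.
    have char27 := char0 (isT : 0 < 27)%N.
    by move=> /eqP; rewrite mulf_eq0 (negPf char27) expf_eq0 /= => /eqP ->.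
  (* The double root, obtained by eliminating x^2 between the cubic and its derivative. *)
  exists (- 3%:R * b / (2%:R * a)); split.
    have -> : 3%:R * (- 3%:R * b / (2%:R * a)) ^+ 2 + a =
      (4%:R * a ^+ 3 + 27%:R * b ^+ 2) / (4%:R * a ^+ 2).
      by field; rewrite a0 !char0.
    by rewrite disc0 mul0r.
  have -> : (- 3%:R * b / (2%:R * a)) ^+ 3 + a * (- 3%:R * b / (2%:R * a)) + b =
    (4%:R * a ^+ 3 + 27%:R * b ^+ 2) * (- b / (8%:R * a ^+ 3)).
    by field; rewrite a0 !char0.
  by rewrite disc0 mul0r.
pose v (i : 'I_3) : K := if i == o0 then x else if i == o1 then 0 else 1.
have grad0 : grad (symt (coefs f)) (mxapp M v) = 0.
  apply: (can_inj (mulmxK M_unit)); rewrite mul0mx -grad_act.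
  apply/rowP => i; rewrite !mxE.
  under eq_bigr do under eq_bigr do rewrite actE mxE.
  move: i; apply: ord3P; rewrite !sum3E !symtE /v /=.
  - transitivity (- 2%:R * c * (3%:R * x ^+ 2 + a)); first by ring.
    by rewrite x1 mulr0.
  - ring.
  - transitivity (- 6%:R * c * (x ^+ 3 + a * x + b)
      + 2%:R * c * x * (3%:R * x ^+ 2 + a)); first by ring.
    by rewrite x1 x2 !mulr0 addr0.
have form0 : cform (symt (coefs f)) (mxapp M v) = 0.
  by rewrite form_grad big1 // => i _; rewrite grad0 mxE mulr0.
have [||i /eqP] := smooth (mxapp M v).
- apply: contrapT => Mv0; have : \col_i mxapp M v i = 0.
    apply/colP => i; rewrite !mxE; apply: contrapT => /eqP Mvi.
    by apply: Mv0; exists i.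
  have -> : \col_i mxapp M v i = M *m \col_i v i.
    by apply/colP => j; rewrite !mxE; apply: eq_bigr => k _; rewrite !mxE.
  move=> /(congr1 (mulmx (invmx M))); rewrite mulKmx // mulmx0 => /colP/(_ o2).
  by rewrite !mxE /v /= => /eqP; rewrite oner_eq0.
- by apply: (mulfI char6); rewrite homogenize3_eval // form0 mulr0.
by apply; apply: (mulfI char2); rewrite homogenize3_grad // grad0 mxE mulr0.
Qed.

Lemma det3_neq0 (M : 'M[K]_3) : M \in unitmx -> det3 M != 0.
Proof.
move=> M_unit; apply: contra_eq_neq (det31 K) => /= d0.
by rewrite -(mulmxV M_unit) det3M d0 mul0r eq_sym oner_eq0.
Qed.

(** Each invariant has degree equal to its weight, 4 for S and 6 for T, so both ratios are powers of
    the single factor k = (c / det M)^2. *)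
Lemma invariants_proportional f a b : (msize f <= 4)%N ->
  proj_equiv (homogenize3 f) (weierstrass a b) ->
  exists k, invS (symt (coefs f)) = k ^+ 2 * (- 1152%:R * a) /\
            invT (symt (coefs f)) = k ^+ 3 * (288%:R * 144%:R * b).
Proof.
move=> f4 /(proj_equiv_act f4)[M [c [/det3_neq0 d0 c0 actE]]].
exists ((c / det3 M) ^+ 2).
have SE : det3 M ^+ 4 * invS (symt (coefs f)) = c ^+ 4 * (- 1152%:R * a).
  by rewrite -invS_act -(invS_wei a b) -invSZ; apply: optrace_ext.
have TE : det3 M ^+ 6 * invT (symt (coefs f)) = c ^+ 6 * (288%:R * 144%:R * b).
  rewrite -invT_act -(invT_wei a b) -invTZ; apply: optrace_ext => // i.
  apply/matrixP => j k; rewrite !mxE; apply: eq_bigr => p _; apply: eq_bigr => q _.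
  by rewrite !actE.
by split; [apply: (mulfI (expf_neq0 4 d0)); rewrite SE|
  apply: (mulfI (expf_neq0 6 d0)); rewrite TE]; field.
Qed.

End WeierstrassForm.

(** * Degeneration to the triangle xyz *)

(** Here 24 T^2 - 4 S^3 equals 1152^3 h^6 (4 a^3 + 27 b^2), which cancels the denominator of j. *)
Lemma jinv_relation (K : fieldType) (a b h S T : K) :
  4%:R * a ^+ 3 + 27%:R * b ^+ 2 != 0 ->
  S = h ^+ 2 * (- 1152%:R * a) -> T = h ^+ 3 * (288%:R * 144%:R * b) ->
  1728%:R * (4%:R * a ^+ 3) / (4%:R * a ^+ 3 + 27%:R * b ^+ 2)
    * (24%:R * T ^+ 2 - 4%:R * S ^+ 3) = - (48%:R * 144%:R) * S ^+ 3.
Proof. by move=> disc0 -> ->; field. Qed.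

Section Degeneration.
Variable C : numFieldType.
Local Notation K := (puiseux C).

Lemma pcoef_nat n (x : K) q : (n%:R * x) q = n%:R * x q.
Proof.
by elim: n => [|n IH]; rewrite ?mul0r // !mulrS !mulrDl !mul1r pcoefD IH.
Qed.

Lemma puiseux_char0 n : (0 < n)%N -> n%:R != 0 :> K.
Proof.
move=> n0; apply/eqP => /(congr1 (fun x : K => (x * 1) 0)) /eqP.
by rewrite mul0r pcoef_nat pcoef1 mulr1 pnatr_eq0 eqn0Ngt n0.
Qed.

Lemma pval_coef_lt (x : K) q : (q%:E < pval x)%E -> forall p, p <= q -> x p = 0.
Proof.
have [-> //|x0] := eqVneq x 0; have [r [-> _ rmin]] := pvalP x0.
rewrite lte_fin => qr p pq; apply/eqP; apply: contraTT pq => /rmin rp.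
by rewrite -ltNge; apply: lt_le_trans rp.
Qed.

Lemma pmono_shift_integral (x : K) e :
  (forall p, p < e -> x p = 0) -> pmono 1 (- e) * x \in @pintegral C.
Proof.
move=> xe; apply/pintegralP => q q0; rewrite pcoef_mono mul1r opprK xe //.
by rewrite gtrDr.
Qed.

Definition reduces_to (x : K) (l : C) : Prop := x \in @pintegral C /\ x 0 = l.

Definition xyz_dominates (c : nat -> nat -> K) (q1 q2 : rat) :=
  exists2 r, pval (c 1%N 1%N) = r%:E & forall v, v \in rim ->
    ((r + ((v.1%:R - 1) * q1 + (v.2%:R - 1) * q2))%:E < pval (c v.1 v.2))%E.

(** The diagonal substitution by powers of t, followed by division by t^r, subtracts the affine
    function from the valuations: it becomes 0 at xyz and positive at all other monomials. *)
Lemma degenerate_tensor (c : nat -> nat -> K) q1 q2 : xyz_dominates c q1 q2 ->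
  exists (M : 'M[K]_3) (s : K) (B : tensor (pint C)) (l : C),
  [/\ l != 0,
      map_tensor (val : pint C -> K) B =1 (fun i => s *: act M (symt c) i) &
      map_tensor (@residue C) B =1 (fun i => l *: symt (@xyzc C) i)].
Proof.
(* With 3g = q1 + q2 the exponents g - q1, g - q2, g sum to 0, so xyz is unchanged and x^m y^n
   z^(3-m-n) is multiplied by t^(-(m-1) q1 - (n-1) q2). *)
move=> [r cr clt]; pose g := (q1 + q2) / 3%:R.
pose d (i : 'I_3) := if i == o0 then g - q1 else if i == o1 then g - q2 else g.
pose M : 'M[K]_3 := \matrix_(i, j) (if i == j then pmono 1 (d i) else 0).
pose b i j k := pmono 1 (- r) * act M (symt c) i j k.
have bE i j k : b i j k = pmono 1 (- (r - d i - d j - d k)) * symt c i j k.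
  have ME p q : M p q = if p == q then pmono 1 (d p) else 0 by rewrite mxE.
  rewrite /b actE (bigD1 i) //= (bigD1 j) //= (bigD1 k) //=.
  rewrite big1 => [|p /negPf pk]; last by rewrite (ME p k) pk mulr0 mul0r.
  rewrite big1 => [|p /negPf pj]; last first.
    by rewrite big1 // => q _; rewrite (ME p j) pj mulr0 !mul0r.
  rewrite big1 => [|p /negPf pi]; last first.
    by rewrite big1 // => q _; rewrite big1 // => q' _; rewrite (ME p i) pi !mul0r.
  rewrite !addr0 !ME !eqxx !mulrA !pmonoM; congr (_ * _); congr (pmono _ _).
    by rewrite !mul1r.
  by ring.
have cv m n k e : (m, n) \in rim ->
    e = r + ((m%:R - 1) * q1 + (n%:R - 1) * q2) ->
    reduces_to (pmono 1 (- e) * (k%:R * c m n)) 0.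
  move=> mn_rim ->; have c0 := pval_coef_lt (clt _ mn_rim); split.
    by apply: pmono_shift_integral => p pe; rewrite pcoef_nat c0 ?mulr0 // ltW.
  by rewrite pcoef_mono mul1r pcoef_nat sub0r opprK c0 // mulr0.
have c1 : c 1%N 1%N != 0 by apply: contra_eq_neq cr => ->; rewrite /pval eqxx.
have [r' []] := pvalP c1; rewrite cr => -[<-] cr0 cmin {r'}.
have cp e : e = r ->
    reduces_to (pmono 1 (- e) * c 1%N 1%N) (c 1%N 1%N r).
  move=> ->; split; last by rewrite pcoef_mono mul1r sub0r opprK.
  apply: pmono_shift_integral => p pr; apply/eqP; apply: contraTT pr.
  by move=> /cmin; rewrite -leNgt.
have bP i j k :
    reduces_to (b i j k) (c 1%N 1%N r * symt (@xyzc C) i j k).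
  rewrite bE; move: i j k; apply: ord3P; apply: ord3P; apply: ord3P;
    rewrite !symtE /d /= ?mulr0;
    first [by apply: cv => //; rewrite /g; field
          |by rewrite !mulr1 mul1r; apply: cp; rewrite /g; field].
(* Every entry is integral by [bP], so the default 0 of [insubd] never occurs. *)
pose B : tensor (pint C) := fun i => \matrix_(j, k) insubd 0 (b i j k).
have BE i j k : val (B i j k) = b i j k.
  by rewrite mxE val_insubd (bP i j k).1.
exists M, (pmono 1 (- r)), B, (c 1%N 1%N r); split=> //.
  by move=> i; apply/matrixP => j k; rewrite [RHS]mxE -[RHS]BE [LHS]mxE.
move=> i; apply/matrixP => j k; rewrite [RHS]mxE -(bP i j k).2 -BE.
by rewrite [LHS]mxE.
Qed.

Lemma xyz_dominates_jinv_val (f : {mpoly K[2]}) q1 q2 j : (msize f <= 4)%N ->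
  smooth_curve (homogenize3 f) -> is_jinv (homogenize3 f) j ->
  xyz_dominates (coefs f) q1 q2 -> (0 < pval j)%E -> False.
Proof.
move=> f4 smooth [a [b [E jE]]] dom /pval_gt0[jO j0].
have disc0 := disc_neq0 puiseux_char0 f4 smooth E.
have [k [SE TE]] := invariants_proportional puiseux_char0 f4 E.
have [M [s [B [l [l0 Bval Bres]]]]] := degenerate_tensor dom.
(* Rescaling by s and substituting M multiply S by (s det M)^4 and T by (s det M)^6, so h takes the
   place of k. *)
pose h := (s * det3 M) ^+ 2 * k.
have SBE : val (invS B) = h ^+ 2 * (- 1152%:R * a).
  rewrite -map_invS (invS_ext Bval) invSZ invS_act SE /h.
  by ring.
have TBE : val (invT B) = h ^+ 3 * (288%:R * 144%:R * b).
  rewrite -map_invT (invT_ext Bval) invTZ invT_act TE /h.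
  by ring.
have SBr : residue (invS B) = l ^+ 4 * 24%:R.
  by rewrite -map_invS (invS_ext Bres) invSZ invS_xyz.
(* All terms are integral, so the relation over the Puiseux series already holds in the valuation
   ring. *)
have rel : PInt jO * (24%:R * invT B ^+ 2 - 4%:R * invS B ^+ 3) =
    - (48%:R * 144%:R) * invS B ^+ 3.
  apply: val_inj; rewrite !(rmorphM, rmorphB, rmorphN, rmorphXn, rmorph_nat).
  have := jinv_relation disc0 SBE TBE; rewrite -jE.
  exact.
(* In the residue field j becomes 0, leaving 0 = -6912 (24 l^4)^3 with l nonzero. *)
have := congr1 (@residue C) rel; rewrite rmorphM /= [residue (PInt jO)]j0 mul0r.
rewrite rmorphM rmorphN rmorphM !rmorph_nat rmorphXn /= SBr => /esym/eqP.
by rewrite mulNr oppr_eq0 !(mulf_eq0, expf_eq0, pnatr_eq0) (negPf l0).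
Qed.

End Degeneration.

Theorem corollary4p2 (R : realType) (f : {mpoly (puiseux R[i])[2]})
    (deg_f : (msize f <= 4)%N) (smooth_f : smooth_curve (homogenize3 f))
    (j : puiseux R[i]) (jE : is_jinv (homogenize3 f) j)
    (val_j : (0 < pval j)%E) :
  ~ has_cycle (tropicalization R f).
Proof.
move=> cycle.
have trop_neq0 m : trop_supp (tropicalization R f) m -> f@_m != 0.
  rewrite /trop_supp /tropicalization /=; apply: contraTneq => ->.
  by rewrite /pval eqxx.
have tri m : trop_supp (tropicalization R f) m ->
    exists2 v, v \in triangle & m = mn v.
  by move=> /trop_neq0; rewrite mcoeff_eq0 negbK; apply: supp_triangle.
have [p_supp [q1 [q2 qP]]] := cycle_exposed_rat tri cycle.
apply: (xyz_dominates_jinv_val deg_f smooth_f jE _ val_j (q1 := q1) (q2 := q2)).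
have [r [rE _ _]] := pvalP (trop_neq0 _ p_supp).
(* A monomial with zero coefficient has valuation +oo and satisfies the bound trivially. *)
exists r => // v vr; have [v0|v0] := eqVneq (coefs f v.1 v.2) 0.
  by rewrite v0 /pval eqxx ltry.
(* The embedding [ratr] preserves and reflects the order, so the inequality between real heights
   descends to rational valuations. *)
have [e [eE _ _]] := pvalP v0; rewrite eE lte_fin -(ltr_rat R).
have tE : tropicalization R f (mn v) = (ratr e)%:E.
  by rewrite /tropicalization -[f@__]/(coefs f v.1 v.2) eE.
have pE : tropicalization R f (mn (1, 1)%N) = (ratr r)%:E.
  by rewrite /tropicalization rE.
have vS : trop_supp (tropicalization R f) (mn v) by rewrite /trop_supp /= tE.
by rewrite rmorphD; have := qP v vr vS; rewrite tE pE.
Qed.
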